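(* Let $N\ge2$, let $\Omega\subset\mathbb{R}^N$ be a bounded domain with smooth boundary, let $1<p_1,p_2<N$, and let the exponents satisfy $$-1<\alpha_1,\beta_2<0,\qquad -1<\beta_1<p_1-1,\qquad -1<\alpha_2<p_2-1.$$ Then, if $\Lambda>0$ is big enough, the problem $$(\mathrm P)\quad\begin{cases}-\Delta_{p_1}u+|u|^{p_1-2}u=u^{\alpha_1}+v^{\beta_1}&\text{in }\Omega,\\ -\Delta_{p_2}v+|v|^{p_2-2}v=u^{\alpha_2}+v^{\beta_2}&\text{in }\Omega,\\ u,v>0&\text{in }\Omega,\\ \frac{\partial u}{\partial\eta}=\frac{\partial v}{\partial\eta}=0&\text{on }\partial\Omega\end{cases}$$ admits a solution $(u,v)\in int\,\mathcal{C}_+^{1,\tau}(\overline\Omega)\times int\,\mathcal{C}_+^{1,\tau}(\overline\Omega)$, for certain $\tau\in(0,1)$, such that $$(u,v)\in[\Lambda^{-1}\hat\phi_{1,p_1},\Lambda\hat y_1]\times[\Lambda^{-1}\hat\phi_{1,p_2},\Lambda\hat y_2],$$ which is unique once $\alpha_2,\beta_1\in(-1,0)$ and the following condition is fulfilled: $$\max\Big\{\frac{-\gamma_1\alpha_i}{p_1-1},\frac{-\gamma_2\beta_i}{p_2-1}\Big\}<p_i-1,\quad i=1,2,\qquad\text{where }\gamma_i=\max\{-\alpha_i,-\beta_i\}.$$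
   Context: $\eta$ is the unit outer normal to $\partial\Omega$; $\Delta_p w=\mathrm{div}(|\nabla w|^{p-2}\nabla w)$. $int\,\mathcal{C}_+^{1,\tau}(\overline\Omega)=\{w\in\mathcal{C}^{1,\tau}(\overline\Omega):w(x)>0\ \forall x\in\overline\Omega\}$; $int\,\mathcal{C}_+^{1}(\overline\Omega)$ is the analogous set in $\mathcal{C}^1(\overline\Omega)$. $(u,v)\in[\underline u,\overline u]\times[\underline v,\overline v]$ means $\underline u\le u\le\overline u$ and $\underline v\le v\le\overline v$ in $\Omega$. A solution of $(\mathrm P)$ is a pair $(u,v)\in W^{1,p_1}(\Omega)\times W^{1,p_2}(\Omega)$ with $u,v>0$ in $\Omega$ and, for all $(\varphi,\psi)\in W^{1,p_1}(\Omega)\times W^{1,p_2}(\Omega)$, $$\int_\Omega|\nabla u|^{p_1-2}\nabla u\cdot\nabla\varphi\,dx+\int_\Omega|u|^{p_1-2}u\varphi\,dx=\int_\Omega(u^{\alpha_1}+v^{\beta_1})\varphi\,dx,$$ $$\int_\Omega|\nabla v|^{p_2-2}\nabla v\cdot\nabla\psi\,dx+\int_\Omega|v|^{p_2-2}v\psi\,dx=\int_\Omega(u^{\alpha_2}+v^{\beta_2})\psi\,dx.$$ For $i=1,2$, $\hat\phi_{1,p_i}\in int\,\mathcal{C}_+^1(\overline\Omega)$ is a (fixed) positive eigenfunction corresponding to the first eigenvalue $\hat\lambda_{1,p_i}>0$ of the Neumann problem $$-\Delta_{p_i}\hat\phi+|\hat\phi|^{p_i-2}\hat\phi=\hat\lambda_{1,p_i}|\hat\phi|^{p_i-2}\hat\phi\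 \text{in }\Omega,\qquad\frac{\partial\hat\phi}{\partial\eta}=0\ \text{on }\partial\Omega,$$ and $\hat y_i\in int\,\mathcal{C}_+^1(\overline\Omega)$ is the unique solution of $$-\Delta_{p_i}\hat y_i+|\hat y_i|^{p_i-2}\hat y_i=1\ \text{in }\Omega,\qquad\frac{\partial\hat y_i}{\partial\eta}=0\ \text{on }\partial\Omega.$$ *)

(* Defs.v *)
From HB Require Import structures.
From mathcomp Require Import all_boot all_order all_algebra.
From mathcomp Require Import all_classical all_reals all_analysis.

Set Implicit Arguments.
Unset Strict Implicit.
Unset Printing Implicit Defensive.

Import Order.TTheory GRing.Theory Num.Theory.
Import numFieldNormedType.Exports.

Local Open Scope classical_set_scope.
Local Open Scope ring_scope.

(* [R^n] is ['rV[R]_n], with the sigma-algebra generated by the coordinates;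
   for R real this is the Borel sigma-algebra. *)
Definition measure_row_display : measure_display -> measure_display.
Proof. exact. Qed.

Section measurable_row.
Context {d} {T : sigmaRingType d}.
Variable n : nat.

Let coors : 'I_n -> 'rV[T]_n -> T := fun i x => x ord0 i.

Let row_set0 : g_sigma_preimage coors set0.
Proof. exact: sigma_algebra0. Qed.

Let row_setC A : g_sigma_preimage coors A -> g_sigma_preimage coors (~` A).
Proof. exact: sigma_algebraC. Qed.

Let row_bigcup (F : _^nat) : (forall i, g_sigma_preimage coors (F i)) ->
  g_sigma_preimage coors (\bigcup_i (F i)).
Proof. exact: sigma_algebra_bigcup. Qed.

HB.instance Definition _ := @isMeasurable.Build (measure_row_display d)
  'rV[T]_n (g_sigma_preimage coors) row_set0 row_setC row_bigcup.

End measurable_row.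

Section measurable_row_lemmas.
Context d1 d2 (T1 : measurableType d1) (T2 : measurableType d2).

Lemma measurable_coord n (i : 'I_n) :
  measurable_fun [set: 'rV[T2]_n] (fun x : 'rV[T2]_n => x ord0 i).
Proof.
move=> _ A mA; rewrite setTI; apply: sub_sigma_algebra.
rewrite -bigcup_seq /=; exists i => /=; first by rewrite mem_index_enum.
by exists A => //; rewrite setTI.
Qed.

Lemma measurable_fun_row n (f : T1 -> 'rV[T2]_n) :
  (forall i, measurable_fun [set: T1] (fun x => f x ord0 i)) ->
  measurable_fun [set: T1] f.
Proof.
move=> mf _ A mA; rewrite setTI.
suff /(_ A mA) : g_sigma_preimage (fun (i : 'I_n) (x : 'rV[T2]_n) => x ord0 i)
    `<=` [set B | measurable (f @^-1` B)] by [].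
apply: smallest_sub; first split => /=.
- by rewrite preimage_set0.
- by move=> B /= mB; rewrite setTD preimage_setC; exact: measurableC.
- by move=> F mF; rewrite preimage_bigcup; exact: bigcup_measurable.
rewrite -bigcup_seq => B [i _ [C mC <-]] /=.
by rewrite setTI; have := mf i measurableT _ mC; rewrite setTI.
Qed.

End measurable_row_lemmas.

Definition cons_row (T : Type) n (p : T * 'rV[T]_n) : 'rV[T]_n.+1 :=
  \row_j (if unlift ord0 j is Some k then p.2 ord0 k else p.1).

Definition uncons_row (T : Type) n (x : 'rV[T]_n.+1) : T * 'rV[T]_n :=
  (x ord0 ord0, \row_k x ord0 (lift ord0 k)).

Lemma cons_rowK T n : cancel (@cons_row T n) (@uncons_row T n).
Proof.
move=> [a v]; rewrite /uncons_row /cons_row mxE unlift_none; congr pair.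
by apply/rowP => k; rewrite !mxE liftK.
Qed.

Lemma uncons_rowK T n : cancel (@uncons_row T n) (@cons_row T n).
Proof.
move=> x; apply/rowP => j; rewrite mxE; case: unliftP => [k|] -> //=.
by rewrite mxE.
Qed.

Lemma measurable_cons_row d (T : measurableType d) n :
  measurable_fun [set: T * 'rV[T]_n] (@cons_row T n).
Proof.
apply: measurable_fun_row => j; rewrite /cons_row.
case: (unliftP ord0 j) => [k|] jE.
  rewrite [X in measurable_fun _ X](_ : _ =
      (fun x : 'rV[T]_n => x ord0 k) \o snd).
    by apply: measurableT_comp => //; exact: measurable_coord.
  by apply/funext => p /=; rewrite mxE jE liftK.
rewrite [X in measurable_fun _ X](_ : _ = fst) //.
by apply/funext => p /=; rewrite mxE jE unlift_none.
Qed.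

Lemma measurable_uncons_row d (T : measurableType d) n :
  measurable_fun [set: 'rV[T]_n.+1] (@uncons_row T n).
Proof.
apply/measurable_fun_pairP; split; first exact: measurable_coord.
apply: measurable_fun_row => k /=.
rewrite [X in measurable_fun _ X](_ : _ = fun x : 'rV[T]_n.+1 => x ord0 (lift ord0 k)).
  exact: measurable_coord.
by apply/funext => x /=; rewrite mxE.
Qed.

Section lebesgue_row.
Variable R : realType.

Section step.
Variables (n : nat) (mu : {sigma_finite_measure set 'rV[R]_n -> \bar R}).

Definition lebesgue_cons : set 'rV[R]_n.+1 -> \bar R :=
  pushforward (@lebesgue_measure R \x mu)%E (@cons_row R n).


Let lebesgue_cons0 : lebesgue_cons set0 = 0%E.
Proof. by rewrite /lebesgue_cons /pushforward preimage_set0 measure0. Qed.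

Let lebesgue_cons_ge0 A : (0 <= lebesgue_cons A)%E.
Proof. by rewrite /lebesgue_cons /pushforward; exact: measure_ge0. Qed.

Let lebesgue_cons_sigma_additive : semi_sigma_additive lebesgue_cons.
Proof.
have mc (B : set 'rV[R]_n.+1) : measurable B ->
    measurable (@cons_row R n @^-1` B).
  by move=> mB; rewrite -[X in measurable X]setTI; exact: measurable_cons_row.
move=> F mF tF mUF; rewrite /lebesgue_cons /pushforward preimage_bigcup.
apply: measure_semi_sigma_additive.
- by move=> k; exact: mc.
- apply/trivIsetP => /= i j _ _ ij; rewrite -preimage_setI.
  by move/trivIsetP : tF => /(_ _ _ _ _ ij) ->//; rewrite preimage_set0.
- by rewrite -preimage_bigcup; exact: mc.
Qed.

HB.instance Definition _ := isMeasure.Build _ _ _ lebesgue_cons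
  lebesgue_cons0 lebesgue_cons_ge0 lebesgue_cons_sigma_additive.

Let lebesgue_cons_sigma_finite : sigma_finite setT lebesgue_cons.
Proof.
have /sigma_finiteP[F [TF ndF Foo]] := sigma_finiteT (@lebesgue_measure R).
have /sigma_finiteP[G [TG ndG Goo]] := sigma_finiteT mu.
exists (fun k => @uncons_row R n @^-1` (F k `*` G k)).
  apply/seteqP; split => // x _.
  have [k _ Fk] : (\bigcup_k F k) (uncons_row x).1 by rewrite -TF.
  have [l _ Gl] : (\bigcup_k G k) (uncons_row x).2 by rewrite -TG.
  exists (maxn k l) => //; split.
  - by move: Fk; exact/subsetPset/ndF/leq_maxl.
  - by move: Gl; exact/subsetPset/ndG/leq_maxr.
move=> k; have [mF Fk] := Foo k; have [mG Gk] := Goo k; split.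
  rewrite -[X in measurable X]setTI.
  exact: (@measurable_uncons_row _ R n measurableT _ (measurableX mF mG)).
rewrite /lebesgue_cons /pushforward (_ : _ @^-1` _ = F k `*` G k); last first.
  by apply/funext => p; rewrite /preimage /mkset cons_rowK.
by rewrite product_measure1E// lte_mul_pinfty// ge0_fin_numE.
Qed.

HB.instance Definition _ := Measure_isSigmaFinite.Build _ _ _ lebesgue_cons
  lebesgue_cons_sigma_finite.

End step.

(* The product measure, transported along R * R^n -> R^n.+1. *)
Fixpoint lebesgue_row n : {sigma_finite_measure set 'rV[R]_n -> \bar R} :=
  match n with
  | 0 => \d_(0 : 'rV[R]_0)
  | n'.+1 => lebesgue_cons (lebesgue_row n')
  end.

End lebesgue_row.

Section domains.
Variables (R : realType) (n : nat).
Implicit Types (u v x : 'rV[R]_n) (f w : 'rV[R]_n -> R) (Omega : set 'rV[R]_n).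

Definition dotp u v : R := \sum_i u ord0 i * v ord0 i.

(* The library norm on ['rV[R]_n] is the sup norm. *)
Definition enorm u : R := Num.sqrt (dotp u u).

Definition partial (i : 'I_n) f : 'rV[R]_n -> R := 'D_(delta_mx 0 i) f.

Definition smooth f : Prop :=
  forall s : seq 'I_n, let g := foldr partial f s in
    continuous g /\ forall i x, derivable g x (delta_mx 0 i).

Definition bounded_domain Omega : Prop :=
  [/\ open Omega, connected Omega, Omega !=set0 & bounded_set Omega].

End domains.

(* Near each boundary point, after singling out a coordinate axis [i] and
   choosing its orientation, [Omega] is the set of points lying strictly above
   the graph of a smooth function of the n - 1 remaining coordinates. *)
Definition smooth_boundary (R : realType) n (Omega : set 'rV[R]_n) : Prop :=
  forall x0, (closure Omega `\` interior Omega) x0 ->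
    exists (i : 'I_n) (b : bool) (gamma : 'rV[R]_n.-1 -> R),
      smooth gamma /\
      \forall x \near x0, Omega x <-> gamma (col' i x) < (-1) ^+ b * x ord0 i.

Section spaces.
Variables (R : realType) (n : nat) (Omega : set 'rV[R]_n).
Implicit Types (f w : 'rV[R]_n -> R) (p tau : R).

(* [w] is continuous on the closure of [Omega], differentiable in [Omega], and
   its partial derivatives extend continuously to the closure. *)
Definition C1_closure w : Prop :=
  {within closure Omega, continuous w} /\
  forall i : 'I_n,
    (forall x, Omega x -> derivable w x (delta_mx 0 i)) /\
    exists g : 'rV[R]_n -> R, {within closure Omega, continuous g} /\
      forall x, Omega x -> g x = partial i w x.

Definition C1tau_closure tau w : Prop :=
  C1_closure w /\
  forall i : 'I_n, exists C : R, forall x y, Omega x -> Omega y ->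
    `|partial i w x - partial i w y| <= C * enorm (x - y) `^ tau.

Definition intC1_pos w : Prop :=
  C1_closure w /\ forall x, closure Omega x -> 0 < w x.

Definition intC1tau_pos tau w : Prop :=
  C1tau_closure tau w /\ forall x, closure Omega x -> 0 < w x.

Local Notation mu := (lebesgue_row R n).

Definition test_function f : Prop :=
  [/\ smooth f, compact (closure [set x | f x != 0]) &
      closure [set x | f x != 0] `<=` Omega].

(* Sobolev functions are represented by total functions, whose
   values outside [Omega] are irrelevant. *)
Definition Lp p w : Prop := (w \_ Omega) \in Lfun mu p%:E.

Definition weak_gradient w (g : 'rV[R]_n -> 'rV[R]_n) : Prop :=
  forall f, test_function f -> forall i : 'I_n,
    \int[mu]_(x in Omega) (w x * partial i f x) =
    - \int[mu]_(x in Omega) (g x ord0 i * f x).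

(* [w] belongs to W^{1,p}(Omega) and [g] is its weak gradient. *)
Definition sobolev p w (g : 'rV[R]_n -> 'rV[R]_n) : Prop :=
  [/\ Lp p w, forall i : 'I_n, Lp p (fun x => g x ord0 i) &
      weak_gradient w g].

(* |s|^(p-2) s and |xi|^(p-2) xi; both are 0 at the origin even when p < 2. *)
Definition spow p (s : R) : R := `|s| `^ (p - 2) * s.
Definition vpow p (xi : 'rV[R]_n) : 'rV[R]_n := enorm xi `^ (p - 2) *: xi.

(* Weak form of
     - Delta_p w + |w|^(p-2) w = h  in Omega,  dw/deta = 0  on the boundary:
   the Neumann condition is encoded by testing against all of W^{1,p}(Omega). *)
Definition weak_neumann p w (h : 'rV[R]_n -> R) : Prop :=
  exists2 dw, sobolev p w dw &
  forall phi dphi, sobolev p phi dphi ->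
    mu.-integrable Omega (fun x => (h x * phi x)%:E) /\
    \int[mu]_(x in Omega) dotp (vpow p (dw x)) (dphi x) +
    \int[mu]_(x in Omega) (spow p (w x) * phi x) =
    \int[mu]_(x in Omega) (h x * phi x).

Definition eigenfunction p (lambda : R) w : Prop :=
  weak_neumann p w (fun x => lambda * spow p (w x)) /\
  ~ {ae mu, forall x, Omega x -> w x = 0}.

Definition first_eigenvalue p (lambda : R) : Prop :=
  (exists w, eigenfunction p lambda w) /\
  forall lambda', (exists w, eigenfunction p lambda' w) -> lambda <= lambda'.

Definition solution_P (p1 p2 alpha1 beta1 alpha2 beta2 : R)
    (u v : 'rV[R]_n -> R) : Prop :=
  [/\ forall x, Omega x -> 0 < u x /\ 0 < v x,
      weak_neumann p1 u (fun x => u x `^ alpha1 + v x `^ beta1) &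
      weak_neumann p2 v (fun x => u x `^ alpha2 + v x `^ beta2)].

Definition in_order_interval (lo hi w : 'rV[R]_n -> R) : Prop :=
  forall x, Omega x -> lo x <= w x <= hi x.

End spaces.

(* Main.v *)
Require Import Defs.
From mathcomp Require Import all_boot all_order all_algebra.
From mathcomp Require Import all_classical all_reals all_analysis.
From mathcomp Require Import measurable_realfun.
From mathcomp Require Import ring lra.
Import Order.TTheory GRing.Theory Num.Theory.
Import numFieldNormedType.Exports.
Local Open Scope classical_set_scope.
Local Open Scope ring_scope.

(**
The Neumann condition is natural for this problem: constants are admissible in
the weak formulation, and a pair of constants [(a, b)] solves the system as soon
as
   [a ^ (p1 - 1) = a ^ alpha1 + b ^ beta1],
   [b ^ (p2 - 1) = a ^ alpha2 + b ^ beta2].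
These two scalar equations have a positive solution ([constant_solution]):
in logarithmic variables the first one defines [ln a] as a Lipschitz function of
[ln b], and the second one is then solved by the intermediate value theorem,
[beta1 < p1 - 1] and [alpha2 < p2 - 1] providing the right growth. Since
[phi1], [phi2], [y1], [y2] lie between positive constants, the order intervals
contain [a] and [b] for all large [Lambda] ([in_order_interval_cst]).

For uniqueness let [(u, v)] be any solution in the class considered, and let [s]
and [t] be the uniform distances of [ln u] to [ln a] and of [ln v] to [ln b].
The datum [u ^ alpha1 + v ^ beta1] then lies between [exp (- m) * a ^ (p1 - 1)]
and [exp m * a ^ (p1 - 1)], where [m] is the larger of [|alpha1| * s] and
[|beta1| * t], and a maximum principle bounds [|ln u - ln a|] by
[m / (p1 - 1)] ([weak_neumann_ln_dist]); similarly for [v]. The exponent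
condition makes these two inequalities contradictory unless [s = t = 0]
([ln_contraction_fixed]), so that [(u, v)] is the constant pair.

The maximum principle ([weak_neumann_comparison]) comes from testing the
equation with [G \o u], where [G] is a nondecreasing truncation: the gradient
term is nonnegative. For this [G \o u] must be shown to be a Sobolev function
with gradient [G' (u) * du], where [du] is whichever weak gradient the
definition of solution provides ([sobolev_comp]). Integration by parts for
functions that are continuously differentiable inside the domain
([domain_integration_by_parts]) shows that [G \o u] and [u] have their classical
gradients as weak gradients, and a variant of the fundamental lemma of the
calculus of variations ([ae_eq0_soft_orthant], [weak_gradient_ae]) identifies
[du] with the classical gradient of [u], almost everywhere on the support of
any test function. The variant multiplies a given test function by the smooth
functions [exp (- k * sum_i exp (k * (x_i - a_i)))], which tend to the indicator
functions of orthants; this avoids any construction of bump functions.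
*)

Set Implicit Arguments.
Unset Strict Implicit.

(** * Constant solutions *)

Lemma continuous_expRZ {R : realType} (c : R) :
  continuous (fun s : R => expR (c * s)).
Proof.
move=> x; apply: (@continuous_comp _ _ _ ( *%R c) expR).
  exact: mulrl_continuous.
exact: continuous_expR.
Qed.

(** The upper bound is there for its growth: with [c = expR (b * t)] and
[t >= 0] it is at most linear in [t], with slope [max b 0 / p]. *)
Lemma expR_equation_solvable {R : realType} (p alpha c : R) :
  0 < p -> alpha < 0 -> 0 < c ->
  exists2 s, 0 <= s <= ln (1 + c) / p & expR (p * s) = expR (alpha * s) + c.
Proof.
move=> p0 a0 c0; set M := ln (1 + c) / p.
have M0 : 0 <= M by rewrite divr_ge0 ?ln_ge0 ?lerDl ?ltW.
have cont : continuous (fun s : R => expR (p * s) - expR (alpha * s)).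
  by move=> x; apply: cvgB; exact: continuous_expRZ.
have pM : expR (p * M) = 1 + c.
  by rewrite /M mulrCA divff ?gt_eqF// mulr1 lnK// posrE addr_gt0.
have aM : expR (alpha * M) <= 1.
  by rewrite -expR0 ler_expR nmulr_rle0.
have [|s] := IVT (v := c) M0 (continuous_subspaceT cont).
  rewrite /= !mulr0 subrr pM ge_min le_max (ltW c0) /=.
  by apply/orP; right; lra.
by rewrite in_itv /= => sM fs; exists s => //; rewrite -fs addrC subrK.
Qed.

(** Replacing [t'] by [t] multiplies [expR (beta * t')] by at most
[expR `|beta * (t - t')|], and passing from [s'] to a larger [s] only decreases
[expR (alpha * s)]; so the right-hand side grows by at most that factor. *)
Lemma expR_equation_lipschitz {R : realType} (p alpha beta s s' t t' : R) :
  0 < p -> alpha < 0 ->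
  expR (p * s) = expR (alpha * s) + expR (beta * t) ->
  expR (p * s') = expR (alpha * s') + expR (beta * t') ->
  p * (s - s') <= `|beta * (t - t')|.
Proof.
move=> p0 a0 Es Es'; set k := `|_|.
have [ss'|s's] := leP s s'.
  by rewrite (le_trans _ (normr_ge0 _))// pmulr_rle0// subr_le0.
have k1 : 1 <= expR k by rewrite -expR0 ler_expR normr_ge0.
suff : expR (p * s) <= expR (k + p * s').
  by rewrite ler_expR mulrBr lerBlDr.
rewrite expRD Es' Es mulrDr lerD//.
  rewrite -[leLHS]mul1r ler_pM ?expR_ge0// ler_expR.
  by rewrite ler_nM2l// ltW.
by rewrite -expRD ler_expR -lerBlDr -mulrBr ler_norm.
Qed.

(** The first equation defines [s = S t], a Lipschitz function of [t]; the
second one is then a scalar equation in [t], solved by the intermediate value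
theorem. It has the wrong sign at [t = 0], and the right one for large [t]
because [a2 * S t] grows with slope at most [max a2 0 * max b1 0 / p < q]. *)
Lemma expR_system_solvable {R : realType} (p q a1 b1 a2 b2 : R) :
  0 < p -> 0 < q -> a1 < 0 -> b2 < 0 -> b1 < p -> a2 < q ->
  exists s t : R, expR (p * s) = expR (a1 * s) + expR (b1 * t) /\
    expR (q * t) = expR (a2 * s) + expR (b2 * t).
Proof.
move=> p0 q0 a10 b20 b1p a2q.
have /choice[S HS] : forall t, exists s, 0 <= s <= ln (1 + expR (b1 * t)) / p /\
    expR (p * s) = expR (a1 * s) + expR (b1 * t).
  move=> t; have [s s1 s2] := expR_equation_solvable p0 a10 (expR_gt0 (b1 * t)).
  by exists s.
have Slip t t' : `|S t - S t'| <= `|b1| / p * `|t - t'|.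
  have [_ E] := HS t; have [_ E'] := HS t'.
  have h := expR_equation_lipschitz p0 a10 E E'.
  have h' := expR_equation_lipschitz p0 a10 E' E.
  rewrite -(opprB t t') mulrN normrN in h'.
  rewrite mulrAC -normrM ler_norml lerNl opprB !ler_pdivlMr//.
  by rewrite ![_ * p]mulrC h h'.
have Scont : continuous S.
  have d0 : 0 < `|b1| / p + 1 by rewrite ltr_wpDl// divr_ge0// ltW.
  move=> t; apply/cvgrPdist_le => e e0; near=> t'.
  apply: (le_trans (Slip t t')).
  rewrite (@le_trans _ _ ((`|b1| / p + 1) * `|t - t'|))//.
    by rewrite ler_wpM2r// lerDl.
  rewrite mulrC -ler_pdivlMr//; near: t'.
  by have /cvgrPdist_le := @cvg_id _ (nbhs t); apply; rewrite divr_gt0.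
pose H t := expR (q * t) - expR (b2 * t) - expR (a2 * S t).
have Hcont : continuous H.
  move=> x; apply: cvgB.
    by apply: cvgB; exact: continuous_expRZ.
  by apply: (@continuous_comp _ _ _ S (fun s => expR (a2 * s)));
    [exact: Scont|exact: continuous_expRZ].
pose m := Num.max b1 0; pose n := Num.max a2 0.
have m0 : 0 <= m by rewrite le_max lexx orbT.
have n0 : 0 <= n by rewrite le_max lexx orbT.
have mp : m < p by rewrite gt_max b1p.
have nq : n < q by rewrite gt_max a2q.
have kq : 0 < q - n * m / p.
  rewrite subr_gt0 (le_lt_trans _ nq)// -mulrA ler_piMr//.
  by rewrite ler_pdivrMr// mul1r ltW.
have l2 : 0 <= ln 2 :> R by rewrite ln_ge0// ler1n.
pose T := (ln 2 + n * ln 2 / p) / (q - n * m / p).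
have T0 : 0 <= T.
  by rewrite divr_ge0// ?(ltW kq)// addr_ge0// divr_ge0 ?mulr_ge0// ltW.
have H0 : H 0 <= 0 by rewrite /H !mulr0 subrr sub0r oppr_le0 expR_ge0.
have HT : 0 <= H T.
  have [/andP[S0 S1] _] := HS T.
  have ST : S T <= (ln 2 + m * T) / p.
    rewrite (le_trans S1)// ler_wpM2r ?invr_ge0 ?(ltW p0)//.
    rewrite -ler_expR lnK ?posrE ?addr_gt0 ?expR_gt0// expRD lnK ?posrE//.
    rewrite mulrDl !mul1r lerD//.
      by rewrite -expR0 ler_expR mulr_ge0.
    by rewrite ler_expR ler_wpM2r// le_max lexx.
  have a2S : a2 * S T <= n * ln 2 / p + n * m / p * T.
    rewrite (@le_trans _ _ (n * S T))//.
      by rewrite ler_wpM2r// le_max lexx.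
    rewrite (le_trans (ler_wpM2l n0 ST))//.
    by rewrite le_eqVlt; apply/orP; left; apply/eqP; ring.
  set z := n * ln 2 / p + n * m / p * T in a2S.
  have pV0 : 0 <= p^-1 by rewrite invr_ge0 ltW.
  have z0 : 0 <= z by apply: addr_ge0; repeat apply: mulr_ge0 => //.
  have qT : q * T = ln 2 + z.
    have -> : q * T = T * (q - n * m / p) + n * m / p * T by ring.
    by rewrite {1}/T divfK ?gt_eqF// /z addrA.
  (* [T] is chosen so that [expR (q * T) = 2 * expR z]: one half dominates
     [expR (a2 * S T)], the other one [expR (b2 * T) <= 1]. *)
  rewrite /H qT expRD lnK ?posrE//.
  have : expR (b2 * T) <= 1 by rewrite -expR0 ler_expR nmulr_rle0.
  have : 1 <= expR z by rewrite -expR0 ler_expR.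
  have : expR (a2 * S T) <= expR z by rewrite ler_expR.
  by lra.
have [|t _ Ht] := IVT (v := 0) T0 (continuous_subspaceT Hcont).
  by rewrite ge_min le_max H0 HT orbT.
exists (S t), t; split; first by have [] := HS t.
by move: Ht; rewrite /H; lra.
Unshelve. all: by end_near. Qed.

(** The logarithms of [a] and [b] solve a system of exponentials, whatever the
signs of [b1] and [a2]. *)
Lemma constant_solution {R : realType} (p q a1 b1 a2 b2 : R) :
  0 < p -> 0 < q -> a1 < 0 -> b2 < 0 -> b1 < p -> a2 < q ->
  exists a b : R, [/\ 0 < a, 0 < b, a `^ p = a `^ a1 + b `^ b1 &
    b `^ q = a `^ a2 + b `^ b2].
Proof.
move=> p0 q0 a10 b20 b1p a2q.
have [s [t [E1 E2]]] := expR_system_solvable p0 q0 a10 b20 b1p a2q.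
have pE (x r : R) : expR x `^ r = expR (r * x).
  by rewrite /powR gt_eqF ?expR_gt0// expRK.
by exists (expR s), (expR t); split; rewrite ?expR_gt0// !pE.
Qed.

(** * Lebesgue measure on row vectors *)

Section row_measure.
Variable R : realType.

Definition cube n (c : 'rV[R]_n) (r : R) : set 'rV[R]_n :=
  [set x | forall i, `|c ord0 i - x ord0 i| < r].

Lemma nbhs_cubeP n (x : 'rV[R]_n) (A : set 'rV[R]_n) :
  nbhs x A <-> exists2 r, 0 < r & cube x r `<=` A.
Proof.
split=> [/nbhs_ballP[r r0 rA]|[r r0 rA]].
  exists r => // y xy; apply: rA; split=> // i j.
  by rewrite (ord1 i); exact: xy.
by apply/nbhs_ballP; exists r => // y [_ xy]; apply: rA => i; exact: xy.
Qed.

Lemma measurable_ballR (x r : R) : measurable (ball x r).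
Proof.
rewrite (_ : ball x r = `]x - r, x + r[%classic) //.
by apply/seteqP; split=> y /=; rewrite /ball/= in_itv/= -ltr_distl distrC.
Qed.

Lemma measurable_cube n (c : 'rV[R]_n) r : measurable (cube c r).
Proof.
rewrite (_ : cube c r = \bigcap_(i in [set: 'I_n])
    [set x | `|c ord0 i - x ord0 i| < r]); last first.
  by apply/seteqP; split=> x xcr i => [_|]; exact: xcr.
apply: fin_bigcap_measurable => [|i _]; first exact: finite_finset.
rewrite -[X in measurable X]setTI.
have /(_ measurableT (ball (c ord0 i) r)) := measurable_coord (T2 := R) i.
by apply; apply: measurable_ballR.
Qed.

(** An open set is a union of cubes with rational centres and radii [1 / k], and
there are only countably many of these. *)
Lemma open_measurable_row n (U : set 'rV[R]_n) : open U -> measurable U.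
Proof.
move=> oU; pose c (q : 'rV[rat]_n) : 'rV[R]_n := map_mx ratr q.
rewrite (_ : U = \bigcup_(qk : 'rV[rat]_n * nat)
    (if `[<cube (c qk.1) (qk.2.+1%:R^-1) `<=` U>]
     then cube (c qk.1) (qk.2.+1%:R^-1) else set0)); last first.
  apply/seteqP; split=> x; last first.
    by move=> [qk _]; case: asboolP => // + /=; exact.
  move=> Ux; have /nbhs_cubeP[r r0 rU] := open_nbhs_nbhs (conj oU Ux).
  have [k k1] : exists k, k.+1%:R^-1 < r / 2.
    have [k _ kr] := near_infty_natSinv_lt (PosNum (divr_gt0 r0 (ltr0n R 2))).
    by exists k; apply: (kr k) => /=.
  have k0 : 0 < k.+1%:R^-1 :> R by rewrite invr_gt0.
  have /choice[q qx] : forall i, exists q : rat,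
      `|ratr q - x ord0 i| < k.+1%:R^-1.
    move=> i; have : x ord0 i - k.+1%:R^-1 < x ord0 i + k.+1%:R^-1.
      by rewrite ltrBlDr -addrA ltrDl addr_gt0.
    move=> /rat_in_itvoo[q].
    by rewrite in_itv/= -ltr_distl => ?; exists q.
  exists ((\row_i q i), k) => //=; case: asboolP => [_|] /=.
    by move=> i; rewrite !mxE.
  case=> y /= yq; apply: rU => i.
  have := yq i; have := qx i; rewrite !mxE => h1 h2.
  rewrite distrC in h1; rewrite (splitr r).
  apply: le_lt_trans (ltrD (lt_trans h1 k1) (lt_trans h2 k1)).
  exact: ler_distD.
apply: countable_bigcupT_measurable => [|qk]; first exact: countableP.
by case: asboolP => // _; exact: measurable_cube.
Qed.

Lemma continuous_measurable_row n (U : set 'rV[R]_n) (f : 'rV[R]_n -> R) :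
  open U -> (forall x, U x -> {for x, continuous f}) -> measurable_fun U f.
Proof.
move=> oU cf; apply: (measurability _ (RGenOpens.measurableE R)).
move=> _ [_ [a [b ->] <-]]; apply: open_measurable_row.
rewrite openE => x [Ux fx]; apply: filterI; first exact: open_nbhs_nbhs.
apply: (cf x Ux); apply: open_nbhs_nbhs; split=> //; exact: interval_open.
Qed.

Lemma lebesgue_row_cube n (c : 'rV[R]_n) r : 0 <= r ->
  lebesgue_row R n (cube c r) = ((r *+ 2) ^+ n)%:E.
Proof.
move=> r0; elim: n c => [c|n IHn c].
  rewrite /= (_ : cube c r = setT) ?diracT//.
  by apply/seteqP; split=> // x _ [].
rewrite /= /lebesgue_cons /pushforward (_ : _ @^-1` _ =
    ball (c ord0 ord0) r `*` cube (uncons_row c).2 r); last first.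
  apply/seteqP; split=> [[t x] /= tx|[t x] /= [ct cx] i].
    split=> [|i]; first by have := tx ord0; rewrite /ball/= mxE unlift_none.
    by have := tx (lift ord0 i); rewrite !mxE liftK.
  rewrite mxE; case: unliftP => [j|] -> //=.
  by have := cx j; rewrite !mxE.
rewrite product_measure1E//; [|exact: measurable_ballR|exact: measurable_cube].
rewrite exprS EFinM; congr (_ * _)%E; last exact: IHn.
exact: lebesgue_measure_ball.
Qed.

Lemma lebesgue_row_cube_lty n (c : 'rV[R]_n) r :
  (lebesgue_row R n (cube c r) < +oo)%E.
Proof.
apply: (@le_lt_trans _ _ (lebesgue_row R n (cube c `|r|))).
  apply: le_measure; rewrite ?inE; [exact: measurable_cube..|].
  by move=> x xr i; exact: lt_le_trans (xr i) (ler_norm r).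
by rewrite lebesgue_row_cube// ltry.
Qed.

Lemma normr_coord_le n (x : 'rV[R]_n) i : `|x ord0 i| <= `|x|.
Proof.
rewrite [leRHS]mx_normrE.
exact: (le_bigmax _ (fun ij => `|x ij.1 ij.2|) (ord0, i)).
Qed.

Lemma bounded_lebesgue_row_lty n (U : set 'rV[R]_n) :
  measurable U -> bounded_set U -> (lebesgue_row R n U < +oo)%E.
Proof.
move=> mU [M [_ MU]].
apply: (@le_lt_trans _ _ (lebesgue_row R n (cube 0 (`|M| + 2)))).
  apply: le_measure; rewrite ?inE//; first exact: measurable_cube.
  move=> x Ux i; rewrite mxE sub0r normrN.
  have Mx : `|x| <= `|M| + 1.
    by apply: MU Ux; rewrite (le_lt_trans (ler_norm _))// ltrDl.
  apply: (@le_lt_trans _ _ (`|M| + 1)); last by rewrite ltrD2l ltr1n.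
  by rewrite (le_trans _ Mx)// normr_coord_le.
exact: lebesgue_row_cube_lty.
Qed.

(** Turns almost everywhere statements about continuous functions into pointwise
ones. *)
Lemma nbhs_lebesgue_row_gt0 n (x : 'rV[R]_n) (U : set 'rV[R]_n) :
  measurable U -> nbhs x U -> (0 < lebesgue_row R n U)%E.
Proof.
move=> mU /nbhs_cubeP[r r0 rU].
apply: (@lt_le_trans _ _ (lebesgue_row R n (cube x r))).
  by rewrite lebesgue_row_cube ?ltW// lte_fin exprn_gt0// mulrn_wgt0.
by apply: le_measure => //; rewrite inE//; exact: measurable_cube.
Qed.

(** Orthants form a system closed under intersection which generates the
sigma-algebra, and their indicator functions are limits of smooth functions. *)
Definition orthant n (a : 'rV[R]_n) : set 'rV[R]_n :=
  [set x | forall i, x ord0 i < a ord0 i].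

Lemma orthantI n : setI_closed (range (@orthant n)).
Proof.
move=> _ _ [a _ <-] [b _ <-].
exists (\row_i Num.min (a ord0 i) (b ord0 i)) => //.
apply/seteqP; split=> x.
  by move=> xab; split=> i; have := xab i; rewrite mxE lt_min => /andP[].
by move=> [xa xb] i; rewrite mxE lt_min xa xb.
Qed.

Lemma measurable_orthant n (a : 'rV[R]_n) : measurable (orthant a).
Proof.
rewrite (_ : orthant a = \bigcap_(i in [set: 'I_n])
    [set x | x ord0 i < a ord0 i]); last first.
  by apply/seteqP; split=> x xa i => [_|]; exact: xa.
apply: fin_bigcap_measurable => [|i _]; first exact: finite_finset.
have := measurable_coord (T2 := R) i measurableT
  (measurable_itv `]-oo, (a ord0 i)[).
by rewrite setTI; congr measurable.
Qed.

Lemma measurable_row_orthantE n :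
  @measurable _ 'rV[R]_n = <<s range (@orthant n) >>.
Proof.
apply/seteqP; split; last first.
  apply: smallest_sub; first exact: sigma_algebra_measurable.
  by move=> _ [a _ <-]; exact: measurable_orthant.
apply: smallest_sub; first exact: smallest_sigma_algebra.
rewrite -bigcup_seq => B [i _ [C mC <-]] /=.
have mcoord : measurable_fun
    (setT : set (g_sigma_algebraType (range (@orthant n))))
    (fun x : 'rV[R]_n => x ord0 i).
  apply: (measurability _ (RGenInftyO.measurableE R)).
  move=> _ [_ [c ->] <-]; rewrite setTI.
  rewrite (_ : _ @^-1` _ = \bigcup_(k : nat)
      orthant (\row_j if j == i then c else k%:R)).
    by apply: bigcupT_measurable => k; apply: sub_sigma_algebra; eexists.
  apply/seteqP; split=> x /=; last first.
    by move=> [k _ /(_ i)]; rewrite mxE eqxx in_itv.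
  rewrite in_itv/= => xc.
  exists (Num.bound `|x|) => // j; rewrite mxE; case: eqP => [->//|_].
  apply: le_lt_trans (archi_boundP (normr_ge0 x)).
  exact: le_trans (ler_norm _) (normr_coord_le _ _).
by have := mcoord measurableT C mC.
Qed.

End row_measure.

(** * The integral of a partial derivative *)

Section integral_of_partial.
Variable R : realType.

(** Directional derivatives only see the restriction to a line, which [L] maps
affinely onto another one. This transports partial derivatives between [R^n.+1]
and its factors [R] and [R^n]. *)
Lemma derive_comp_line (V W : normedModType R) (F : W -> R) (L : V -> W)
    (x v : V) (w : W) :
  (forall h : R, L (h *: v + x) = h *: w + L x) ->
  (derivable (F \o L) x v <-> derivable F (L x) w) /\
  'D_v (F \o L) x = 'D_w F (L x).
Proof.
move=> Lx; rewrite /derivable /derive.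
have -> : (fun h => h^-1 *: (((F \o L) \o shift x) (h *: v) - (F \o L) x)) =
    (fun h => h^-1 *: ((F \o shift (L x)) (h *: w) - F (L x))).
  by apply/funext => h /=; rewrite Lx.
by [].
Qed.

Lemma derive_eq0_near (V : normedModType R) (F : V -> R) x v :
  (\near x, F x = 0) -> derivable F x v /\ 'D_v F x = 0.
Proof.
move=> F0; split.
  apply: (@near_eq_derivable _ _ _ (cst 0)); last exact: derivable_cst.
  by apply: filterS F0 => y ->.
by rewrite (@near_eq_derive _ _ _ F (cst 0))// derive_cst.
Qed.

Lemma cube_compactN n (x : 'rV[R]_n) M : ~ cube 0 (M + 1) x ->
  \near x, ~ cube 0 M x.
Proof.
move=> xM; apply/nbhs_cubeP; exists 1 => // y xy yM; apply: xM => i.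
have := xy i; have := yM i; rewrite !mxE !sub0r !normrN => y1 y2.
apply: le_lt_trans (ltrD y1 y2).
rewrite addrC; have := ler_normD (x ord0 i - y ord0 i) (y ord0 i).
by rewrite subrK.
Qed.

Lemma continuous_supported_bounded n (g : 'rV[R]_n -> R) M :
  continuous g -> (forall x, ~ cube 0 M x -> g x = 0) ->
  exists2 B, 0 <= B & forall x, `|g x| <= B.
Proof.
move=> cg gM.
have cK : compact [set x : 'rV[R]_n | forall i, `[- M, M]%classic (x ord0 i)].
  apply: (@rV_compact R n (fun=> `[- M, M]%classic)) => _.
  exact: segment_compact.
have [B [_ BP]] := compact_bounded (continuous_compact
  (continuous_subspaceT cg) cK).
exists (`|B| + 1); first by rewrite addr_ge0.
move=> x; have [xM|xM] := pselect (cube 0 M x).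
  apply: (BP (`|B| + 1)); first by rewrite (le_lt_trans (ler_norm _))// ltrDl.
  exists x => // i /=; rewrite in_itv/= -ler_norml.
  by have := xM i; rewrite mxE sub0r normrN => /ltW.
by rewrite gM// normr0 addr_ge0.
Qed.

Lemma integrable_continuous_supported n (g : 'rV[R]_n -> R) M :
  continuous g -> (forall x, ~ cube 0 M x -> g x = 0) ->
  (lebesgue_row R n).-integrable setT (EFin \o g).
Proof.
move=> cg gM; have [B B0 gB] := continuous_supported_bounded cg gM.
have mg : measurable_fun setT g.
  by apply: continuous_measurable_row => [|x _]; [exact: openT|exact: cg].
have -> : EFin \o g = (EFin \o g) \_ (cube 0 M).
  by apply/funext => x; rewrite patchE /=; case: ifPn => //;
    rewrite notin_setE => /gM ->.
apply/(integrable_mkcond _ (measurable_cube 0 M)).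
apply: measurable_bounded_integrable.
- exact: measurable_cube.
- exact: lebesgue_row_cube_lty.
- exact: measurable_funTS.
- exists B; split; first exact: num_real.
  by move=> C BC x _; exact: le_trans (gB x) (ltW BC).
Qed.

Lemma cube_cons n (t : R) (y : 'rV[R]_n) M :
  cube 0 M (cons_row (t, y)) <-> `|t| < M /\ cube 0 M y.
Proof.
split=> [h|[tM yM] i].
  split=> [|i].
    by have := h ord0; rewrite !mxE unlift_none sub0r normrN.
  by have := h (lift ord0 i); rewrite !mxE liftK.
rewrite !mxE; case: unliftP => [j|] _ /=; last by rewrite sub0r normrN.
by have := yM j; rewrite !mxE.
Qed.

Lemma continuous_cons_row_head n (y : 'rV[R]_n) :
  continuous (fun t : R => cons_row (t, y)).
Proof.
move=> t A /nbhs_cubeP[r r0 rA]; apply/nbhs_ballP; exists r => // t' tt'.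
apply: rA => i; rewrite !mxE.
by case: unliftP => [j|] _ /=; [rewrite subrr normr0|exact: tt'].
Qed.

Lemma continuous_cons_row_tail n (t : R) :
  continuous (fun y : 'rV[R]_n => cons_row (t, y)).
Proof.
move=> y A /nbhs_cubeP[r r0 rA]; apply/nbhs_cubeP; exists r => // y' yy'.
apply: rA => i; rewrite !mxE.
by case: unliftP => [j|] _ /=; [exact: yy'|rewrite subrr normr0].
Qed.

Lemma integral_derive1_supported (phi : R -> R) (M : R) :
  (forall t, derivable phi t 1) -> continuous (derive1 phi) ->
  (forall t, M <= `|t| -> phi t = 0) ->
  (\int[lebesgue_measure]_t (derive1 phi t)%:E = 0)%E.
Proof.
move=> dphi cphi phi0.
have cp : continuous phi.
  by move=> t; apply: differentiable_continuous; exact/derivable1_diffP.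
pose K : R := `|M| + 1.
have K0 : 0 < K by rewrite ltr_pwDr.
have MK : M < K by rewrite (le_lt_trans (ler_norm _))// ltrDl.
have phi'0 t : K <= `|t| -> derive1 phi t = 0.
  move=> Kt; rewrite derive1E; apply: (proj2 (derive_eq0_near _ _)).
  have : M < `|t| by exact: lt_le_trans Kt.
  move=> Mt; near=> s; apply: phi0; apply: ltW; near: s.
  by apply: (cvgr_gt `|t|) => //; exact: norm_continuous.
pose I : set R := `[- K, K]%classic.
transitivity (\int[lebesgue_measure]_(t in I) (derive1 phi t)%:E)%E.
  rewrite [RHS]integral_mkcond; apply: eq_integral => t _.
  rewrite patchE; case: ifPn => //; rewrite notin_setE /I /= in_itv/= => /negP.
  by rewrite -ler_norml -ltNge => /ltW/phi'0 ->.
have KK : - K < K by rewrite gtrN.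
rewrite /I (continuous_FTC2 KK (F := phi)).
- have MK' : M <= `|K| by rewrite (le_trans (ltW MK))// ler_norm.
  by rewrite !phi0 ?normrN// subee.
- exact: continuous_subspaceT.
- split; first by move=> t _; exact: dphi.
  + exact/cvg_at_right_filter/cp.
  + exact/cvg_at_left_filter/cp.
- by [].
Unshelve. all: by end_near. Qed.

(** The induction follows the recursive construction of the measure: by Fubini,
either the derivative is taken along the first factor, where the fundamental
theorem of calculus applies on each line, or along the second one, where the
induction hypothesis applies on each slice. *)
Lemma integral_partial_supported n (i : 'I_n) (F : 'rV[R]_n -> R) M :
  (forall x, derivable F x (delta_mx 0 i)) -> continuous (partial i F) ->
  (forall x, ~ cube 0 M x -> F x = 0) ->
  (\int[lebesgue_row R n]_x (partial i F x)%:E = 0)%E.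
Proof.
elim: n i F => [[]//|n IHn] i F dF cF F0.
set g := partial i F.
have g0 x : ~ cube 0 (M + 1) x -> g x = 0.
  move=> /cube_compactN xM; apply: (proj2 (derive_eq0_near _ _)).
  by apply: filterS xM => z; exact: F0.
have ig := integrable_continuous_supported cF g0.
have mg : measurable_fun setT g.
  by apply: continuous_measurable_row => [|x _]; [exact: openT|exact: cF].
have mc := @measurable_cons_row _ R n.
have igc : (lebesgue_measure \x lebesgue_row R n)%E.-integrable setT
    ((EFin \o g) \o @cons_row R n).
  apply/integrableP; split.
    by apply/measurable_EFinP; exact: (measurableT_comp mg mc).
  move/integrableP : ig => [_]; rewrite /= ge0_integral_pushforward//.
  by apply/measurable_EFinP; exact: (measurableT_comp _ mg).
transitivity (\int[lebesgue_measure \x lebesgue_row R n]_p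
    ((EFin \o g) \o @cons_row R n) p)%E.
  by rewrite /= integral_pushforward//; exact/measurable_EFinP.
case: (unliftP ord0 i) => [k|] iE.
  rewrite -integral12_prod_meas1// integral0_eq// => t _.
  rewrite /fubini_F /=.
  have Lk y (h : R) : cons_row (t, h *: delta_mx 0 k + y) =
      h *: delta_mx 0 i + cons_row (t, y).
    apply/rowP => j; rewrite !mxE /=; case: unliftP => [j'|] -> /=.
      by rewrite !mxE iE (inj_eq (@lift_inj _ ord0)).
    by rewrite iE mulr0 add0r.
  have D y := @derive_comp_line 'rV[R]_n 'rV[R]_n.+1 F
    (fun y => cons_row (t, y)) y _ _ (Lk y).
  have gE y :
      g (cons_row (t, y)) = partial k (F \o (fun y => cons_row (t, y))) y.
    by rewrite /g /partial (D y).2.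
  under eq_integral do rewrite gE.
  apply: IHn => [y| |y yM].
  - by apply/(D y).1; exact: dF.
  - rewrite (_ : partial _ _ = g \o (fun y => cons_row (t, y))); last first.
      by apply/funext => y; rewrite -gE.
    move=> y; apply: (@continuous_comp _ _ _ (fun y => cons_row (t, y)) g);
      last exact: cF.
    exact: continuous_cons_row_tail.
  - by apply: F0 => /cube_cons[].
rewrite -integral21_prod_meas1// integral0_eq// => y _.
rewrite /fubini_G /=.
have L0 t (h : R) : cons_row (h *: 1 + t, y) =
    h *: delta_mx 0 i + cons_row (t, y).
  apply/rowP => j; rewrite !mxE /= iE; case: unliftP => [j'|] -> /=.
    by rewrite mulr0 add0r.
  by rewrite -[_ *: 1]/(_ * 1).
have D t := @derive_comp_line R 'rV[R]_n.+1 F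
  (fun t => cons_row (t, y)) t _ _ (L0 t).
have gE t : g (cons_row (t, y)) = derive1 (F \o (fun t => cons_row (t, y))) t.
  by rewrite derive1E (D t).2.
under eq_integral do rewrite gE.
apply: (@integral_derive1_supported _ M) => [t| |t tM].
- by apply/(D t).1; exact: dF.
- rewrite (_ : derive1 _ = g \o (fun t => cons_row (t, y))); last first.
    by apply/funext => t; rewrite -gE.
  move=> t; apply: (@continuous_comp _ _ _ (fun t => cons_row (t, y)) g);
    last exact: cF.
  exact: continuous_cons_row_head.
- by apply: F0 => /cube_cons[]; rewrite ltNge tM.
Qed.

End integral_of_partial.

(** * Algebra of smooth functions *)

(** Reduced to the chain rule on [R] by restricting [f] to a line through [x]:
the chain rule for differentials does not apply, as [f] only has a derivative
along [v]. *)
Lemma derive_comp1 (R : realType) (V : normedModType R) (G : R -> R)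
    (f : V -> R) (x v : V) :
  derivable f x v -> derivable G (f x) 1 ->
  derivable (G \o f) x v /\ 'D_v (G \o f) x = derive1 G (f x) * 'D_v f x.
Proof.
have [L [t [Lx <-]]] : exists L : R -> V, exists t,
    (forall h : R, L (h *: 1 + t) = h *: v + L t) /\ L t = x.
  exists (fun t => t *: v + x), 0; rewrite scale0r add0r; split=> // h.
  by rewrite addr0 -[h *: 1]/(h * 1) mulr1.
have [Hf Df] := @derive_comp_line R R V f L t 1 v Lx.
have [HG DG] := @derive_comp_line R R V (G \o f) L t 1 v Lx.
move=> /(proj2 Hf) df dG.
have dGf : derivable (G \o (f \o L)) t 1.
  apply: (proj2 (derivable1_diffP _ _)).
  apply: (@differentiable_comp _ _ _ _ (f \o L) G).
  exact (proj1 (derivable1_diffP _ _) df).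
  exact (proj1 (derivable1_diffP _ _) dG).
split; first exact: (proj1 HG).
rewrite -Df -DG -(derive1E (G \o (f \o L))) -(derive1E (f \o L)).
exact (@derive1_comp R (f \o L) G t df dG).
Qed.

Section smooth_algebra.
Variables (R : realType) (n : nat).
Implicit Types f g : 'rV[R]_n -> R.

(** The finite levels of [smooth], on which closure under algebraic operations
can be proved by induction: the Leibniz rule turns a derivative of a product
into products of functions that are smooth one level less. *)
Fixpoint smooth_upto (k : nat) f : Prop :=
  [/\ continuous f, forall i x, derivable f x (delta_mx 0 i) &
    if k is k'.+1 then forall i, smooth_upto k' (partial i f) else True].

Lemma smooth_uptoS k f : smooth_upto k.+1 f -> smooth_upto k f.
Proof.
elim: k f => [|k IHk] f /= [cf df pf]; split => // i.
by apply: IHk; exact: pf.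
Qed.

Lemma smooth_uptoP f : smooth f <-> forall k, smooth_upto k f.
Proof.
split=> [sf k|sf s].
  elim: k f sf => [|k IHk] f sf; have [cf df] := sf [::]; split => // i.
  by apply: IHk => s; rewrite -foldr_rcons; exact: sf.
elim/last_ind: s f sf => [|s i IHs] f sf; first by have [] := sf 0%N.
by rewrite foldr_rcons; apply: IHs => k; have [_ _] := sf k.+1; exact.
Qed.

Lemma smooth_uptoD k f g :
  smooth_upto k f -> smooth_upto k g -> smooth_upto k (f \+ g).
Proof.
elim: k f g => [|k IHk] f g [cf df pf] [cg dg pg];
  (split; [exact: (fun x => continuousD (cf x) (cg x))
          |exact: (fun i x => derivableD (df i x) (dg i x))|]).
  by [].
move=> i; rewrite (_ : partial i _ = partial i f \+ partial i g).
  exact: (IHk _ _ (pf i) (pg i)).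
by apply/funext => x; exact: (deriveD (df i x) (dg i x)).
Qed.

Lemma smooth_uptoM k f g :
  smooth_upto k f -> smooth_upto k g -> smooth_upto k (f \* g).
Proof.
elim: k f g => [|k IHk] f g sf sg; have [cf df pf] := sf; have [cg dg pg] := sg;
  (split; [exact: (fun x => continuousM (cf x) (cg x))
          |exact: (fun i x => derivableM (df i x) (dg i x))|]).
  by [].
move=> i; rewrite (_ : partial i _ = (f \* partial i g) \+ (g \* partial i f)).
  apply: smooth_uptoD.
    exact: (IHk _ _ (smooth_uptoS sf) (pg i)).
  exact: (IHk _ _ (smooth_uptoS sg) (pf i)).
by apply/funext => x; exact: (deriveM (df i x) (dg i x)).
Qed.

Lemma smooth_upto_cst k (c : R) : smooth_upto k (cst c).
Proof.
elim: k c => [|k IHk] c; (split; [exact: cst_continuous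
  |exact: (fun i x => derivable_cst _ _ _)|]); first by [].
move=> i; rewrite (_ : partial i _ = cst 0); first exact: IHk.
by apply/funext => x; rewrite /partial derive_cst.
Qed.

Lemma derive_coord (j : 'I_n) (x v : 'rV[R]_n) :
  derivable (fun x : 'rV[R]_n => x ord0 j) x v /\
  'D_v (fun x : 'rV[R]_n => x ord0 j) x = v ord0 j.
Proof.
have E : (fun h : R => h^-1 *: (((fun x : 'rV[R]_n => x ord0 j) \o shift x)
    (h *: v) - x ord0 j)) @ 0^' --> v ord0 j.
  apply: cvg_near_cst; near=> h.
  rewrite /= !mxE addrK -[LHS]/(h^-1 * (h * _)) mulKf//.
  by near: h; exact: nbhs_dnbhs_neq.
split; first by apply/cvg_ex; exists (v ord0 j).
exact/cvg_lim.
Unshelve. all: by end_near. Qed.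

Lemma smooth_upto_coord k (j : 'I_n) :
  smooth_upto k (fun x : 'rV[R]_n => x ord0 j).
Proof.
have cj : continuous (fun x : 'rV[R]_n => x ord0 j).
  by move=> x; exact: coord_continuous.
case: k => [|k]; (split; [exact: cj|
  exact: (fun i x => (derive_coord j x _).1)|]); first by [].
move=> i; rewrite (_ : partial i _ = cst ((delta_mx 0 i : 'rV[R]_n) ord0 j)).
  exact: smooth_upto_cst.
by apply/funext => x; exact: (derive_coord j x _).2.
Qed.

Lemma smooth_upto_expR k f : smooth_upto k f -> smooth_upto k (expR \o f).
Proof.
have De g i x : derivable g x (delta_mx 0 i) ->
    derivable (expR \o g) x (delta_mx 0 i) /\
    partial i (expR \o g) x = expR (g x) * partial i g x.
  move=> dgx; have [D1 D2] := derive_comp1 dgx (@derivable_expR R (g x)).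
  by split; [exact: D1|rewrite /partial D2 derive1E derive_val].
elim: k f => [|k IHk] f sf; have [cf df pf] := sf;
  (split; [exact: (fun x => continuous_comp (cf x) (@continuous_expR R (f x)))
          |exact: (fun i x => (De f i x (df i x)).1)|]); first by [].
move=> i; rewrite (_ : partial i _ = (expR \o f) \* partial i f).
  exact: (smooth_uptoM (IHk _ (smooth_uptoS sf)) (pf i)).
by apply/funext => x; exact: (De f i x (df i x)).2.
Qed.

Lemma smooth_upto_sum k (I : Type) (r : seq I) (F : I -> 'rV[R]_n -> R) :
  (forall i, smooth_upto k (F i)) ->
  smooth_upto k (fun x => \sum_(i <- r) F i x).
Proof.
move=> sF; elim: r => [|i r IHr].
  rewrite (_ : (fun _ => _) = cst 0); first exact: smooth_upto_cst.
  by apply/funext => x; rewrite big_nil.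
rewrite (_ : (fun _ => _) = F i \+ (fun x => \sum_(i <- r) F i x)).
  exact: smooth_uptoD.
by apply/funext => x; rewrite big_cons.
Qed.

(** Smooth approximations of the indicator function of [orthant a]: where all
[x_i < a_i] the exponent tends to 0, elsewhere it is at most [- k.+1]. They are
not compactly supported; they are only used as factors of a test function. *)
Definition soft_orthant (a : 'rV[R]_n) (k : nat) (x : 'rV[R]_n) : R :=
  expR (- k.+1%:R * \sum_i expR (k.+1%:R * (x ord0 i - a ord0 i))).

Lemma smooth_soft_orthant a k : smooth (soft_orthant a k).
Proof.
apply/smooth_uptoP => m.
rewrite (_ : soft_orthant a k = expR \o (cst (- k.+1%:R) \* (fun x =>
  \sum_i (expR \o (cst k.+1%:R \* ((fun x : 'rV[R]_n => x ord0 i) \+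
  cst (- a ord0 i)))) x)))//.
apply: smooth_upto_expR; apply: smooth_uptoM; first exact: smooth_upto_cst.
apply: smooth_upto_sum => i; apply: smooth_upto_expR.
apply: smooth_uptoM; first exact: smooth_upto_cst.
apply: smooth_uptoD; first exact: smooth_upto_coord.
exact: smooth_upto_cst.
Qed.

Lemma smoothM f g : smooth f -> smooth g -> smooth (f \* g).
Proof.
move=> /smooth_uptoP sf /smooth_uptoP sg.
by apply/smooth_uptoP => k; exact: smooth_uptoM.
Qed.

Lemma soft_orthant_ge0 a k x : 0 <= soft_orthant a k x.
Proof. exact: expR_ge0. Qed.

Lemma soft_orthant_le1 a k x : soft_orthant a k x <= 1.
Proof.
rewrite -expR0 ler_expR mulNr oppr_le0 mulr_ge0//.
by apply: sumr_ge0 => i _; exact: expR_ge0.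
Qed.

End smooth_algebra.

(** * A fundamental lemma of the calculus of variations *)

Section fundamental_lemma.
Variables (R : realType) (n : nat).
Local Notation mu := (lebesgue_row R n).

Lemma cvg_natr_expRN (d : R) : 0 < d ->
  (fun k : nat => k.+1%:R * expR (- (k.+1%:R * d))) @ \oo --> (0 : R).
Proof.
move=> d0; apply: (@squeeze_cvgr _ _ _ _ (cst 0)
  (fun k => 2 / d ^+ 2 * harmonic k)).
- near=> k; rewrite mulr_ge0 ?expR_ge0//= expRN.
  have kd0 : 0 < k.+1%:R * d by rewrite mulr_gt0.
  have E : (k.+1%:R * d) ^+ 2 / 2 <= expR (k.+1%:R * d).
    by rewrite (le_trans _ (expR_ge1Dxn 1%N (ltW kd0)))// lerDr.
  rewrite ler_pdivrMr ?expR_gt0//.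
  apply: le_trans (ler_wpM2l _ E); last first.
    by rewrite /harmonic mulr_ge0 ?divr_ge0 ?invr_ge0 ?exprn_ge0 ?ltW.
  rewrite le_eqVlt; apply/orP; left; apply/eqP; rewrite /harmonic.
  by field; rewrite gt_eqF//= gt_eqF.
- exact: cvg_cst.
- rewrite -[X in _ --> X](mulr0 (2 / d ^+ 2)).
  by apply: cvgM; [exact: cvg_cst|exact: cvg_harmonic].
Unshelve. all: by end_near. Qed.

Lemma cvg_soft_orthant (a x : 'rV[R]_n) :
  soft_orthant a k x @[k --> \oo] --> (\1_(orthant a) x : R).
Proof.
rewrite indicE; case: (boolP (x \in orthant a)) => [/set_mem xa|].
  rewrite -expR0; apply: continuous_cvg; first exact: continuous_expR.
  rewrite (_ : (fun k => _) = (fun k : nat => - \sum_i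
      (k.+1%:R * expR (- (k.+1%:R * (a ord0 i - x ord0 i)))))); last first.
    apply/funext => k; rewrite mulNr mulr_sumr; congr (- _).
    by apply: eq_bigr => i _; rewrite -mulrN opprB.
  rewrite -[X in _ --> X]oppr0; apply: cvgN.
  pose e i (k : nat) := k.+1%:R * expR (- (k.+1%:R * (a ord0 i - x ord0 i))).
  have e0 i : e i @ \oo --> (0 : R).
    by apply: cvg_natr_expRN; rewrite subr_gt0; exact: xa.
  suff : forall r : seq 'I_n,
      (fun k => \sum_(i <- r) e i k) @ \oo --> (0 : R).
    by exact.
  elim=> [|i r IHr].
    rewrite (_ : (fun _ => _) = cst 0); first exact: cvg_cst.
    by apply/funext => k; rewrite big_nil.
  rewrite (_ : (fun _ => _) =
      e i \+ (fun k => \sum_(i <- r) e i k)); last first.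
    by apply/funext => k; rewrite big_cons.
  by rewrite -[X in _ --> X](addr0 0); exact: cvgD (e0 i) IHr.
rewrite notin_setE => /existsNP[i /negP]; rewrite -leNgt => ai.
apply: (@squeeze_cvgr _ _ _ _ (cst 0) harmonic).
- near=> k; rewrite soft_orthant_ge0/= /soft_orthant mulNr expRN /harmonic.
  rewrite lef_pV2 ?posrE ?expR_gt0//.
  apply: (@le_trans _ _ (expR k.+1%:R)).
    by rewrite (le_trans _ (expR_ge1Dx _))// lerDr.
  rewrite ler_expR ler_peMr// (bigD1 i)//= ler_wpDr//.
    by apply: sumr_ge0 => j _; exact: expR_ge0.
  by rewrite -expR0 ler_expR mulr_ge0// subr_ge0.
- exact: cvg_cst.
- exact: cvg_harmonic.
Unshelve. all: by end_near. Qed.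

Lemma integral_mul_lim_eq0 (K : 'rV[R]_n -> R) (g_ : nat -> 'rV[R]_n -> R) g :
  mu.-integrable setT (EFin \o K) ->
  (forall k, measurable_fun setT (g_ k)) -> (forall k x, `|g_ k x| <= 1) ->
  (forall x, g_ k x @[k --> \oo] --> g x) ->
  (forall k, (\int[mu]_x (K x * g_ k x)%:E = 0)%E) ->
  (\int[mu]_x (K x * g x)%:E = 0)%E.
Proof.
move=> iK mg g1 gcvg Kg0.
have mK : measurable_fun setT K.
  by apply/measurable_EFinP; exact: measurable_int iK.
have mg' : measurable_fun setT g.
  by apply: measurable_fun_cvg mg _ => x _; exact: gcvg.
have [//| |//| | |_ _] := @dominated_convergence _ _ _ mu setT measurableT
  (fun k x => (K x * g_ k x)%:E) (fun x => (K x * g x)%:E)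
  (abse \o (EFin \o K)).
- by move=> k; apply/measurable_EFinP; exact: measurable_funM.
- by apply/measurable_EFinP; exact: measurable_funM.
- apply: aeW => x _; apply: cvg_EFin; first by near=> k.
  by apply: cvgM; [exact: cvg_cst|exact: gcvg].
- exact: integrable_abse.
- apply: aeW => x k _; rewrite lee_fin normrM ler_piMr//.
rewrite (_ : [sequence _]_n = cst 0%E); last first.
  by apply/funext => k; exact: Kg0.
by move=> H; symmetry; apply: cvg_unique (cvg_cst _) H.
Unshelve. all: by end_near. Qed.

(** The whole space, which the pi-lambda theorem needs, is reached through the
orthants below the diagonal points [(k, ..., k)]. *)
Lemma orthants_exhaust (x : 'rV[R]_n) :
  (\1_(orthant (const_mx k%:R)) x : R) @[k --> \oo] --> (1 : R).
Proof.
apply: cvg_near_cst; near=> k; rewrite indicE mem_set// => i; rewrite mxE.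
apply: (le_lt_trans (le_trans (ler_norm _) (normr_coord_le x i))).
apply: (lt_le_trans (archi_boundP (normr_ge0 x))).
by rewrite ler_nat; near: k; exact: nbhs_infty_ge.
Unshelve. all: by end_near. Qed.

(** By dominated convergence the integral of [K] over every orthant vanishes; by
the pi-lambda theorem so does its integral over every measurable set. *)
Lemma ae_eq0_soft_orthant (K : 'rV[R]_n -> R) :
  mu.-integrable setT (EFin \o K) ->
  (forall a k, (\int[mu]_x (K x * soft_orthant a k x)%:E = 0)%E) ->
  {ae mu, forall x, K x = 0}.
Proof.
move=> iK K0.
have mK : measurable_fun setT K.
  by apply/measurable_EFinP; exact: measurable_int iK.
have m1 (a : 'rV[R]_n) : measurable_fun setT (\1_(orthant a) : 'rV[R]_n -> R).
  by apply: measurable_indic; exact: measurable_orthant.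
have n1 (a x : 'rV[R]_n) : `|\1_(orthant a) x : R| <= 1.
  by rewrite indicE ger0_norm// lern1 leq_b1.
have KO a : (\int[mu]_x (K x * \1_(orthant a) x)%:E = 0)%E.
  apply: (integral_mul_lim_eq0 iK _ _ (@cvg_soft_orthant a) (K0 a)).
    move=> k; apply: continuous_measurable_row => [|x _]; first exact: openT.
    by have [c _] := smooth_soft_orthant a k [::]; exact: c.
  by move=> k x; rewrite ger0_norm ?soft_orthant_ge0 ?soft_orthant_le1.
have KT : (\int[mu]_x (K x)%:E = 0)%E.
  have := integral_mul_lim_eq0 (g_ := fun k => \1_(orthant (const_mx k%:R)))
    iK (fun k => m1 _) (fun k => n1 _) orthants_exhaust (fun k => KO _).
  by under eq_integral do rewrite mulr1.
have iKS S : measurable S -> mu.-integrable S (EFin \o K).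
  by move=> mS; exact: integrableS iK.
have KS S : measurable S -> (\int[mu]_(x in S) (K x)%:E = 0)%E.
  move=> mS; have := mS; rewrite measurable_row_orthantE => sS.
  apply: (dynkin_induction (P := fun S => (\int[mu]_(x in S) (K x)%:E = 0)%E)
    (measurable_row_orthantE R n) (@orthantI R n)) sS => //.
  - move=> _ [a _ <-]; rewrite integral_mkcond -[RHS](KO a).
    by apply: eq_integral => x _; rewrite epatch_indic /= EFinM.
  - move=> A mA KA; have := KT.
    rewrite -(setUv A) integral_setU//=.
    + by rewrite KA add0e.
    + exact: measurableC.
    + by rewrite setUv; apply/measurable_EFinP.
    + by apply/disj_setPS; rewrite setICr.
  - move=> F mF tF KF; rewrite integral_bigcup//.
      by rewrite eseries0// => k _ _; exact: KF.
    by apply: iKS; exact: bigcup_measurable.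
have := @integral_ae_eq _ _ _ mu setT measurableT (cst 0%E) (EFin \o K) iK
  (measurable_cst _).
case=> [E _ mE|N [mN N0 NK]]; first by rewrite KS// integral0.
exists N; split=> // x /= Kx; apply: NK => /= /(_ I)[K0x].
by apply: Kx.
Qed.

End fundamental_lemma.

(** * Lebesgue spaces on a bounded open set *)

Section domain.
Variables (R : realType) (n : nat) (Omega : set 'rV[R]_n).
Hypotheses (oOmega : open Omega) (bOmega : bounded_set Omega).
Local Notation mu := (lebesgue_row R n).

Lemma measurable_domain : measurable Omega.
Proof. exact: open_measurable_row. Qed.
Local Notation mOmega := measurable_domain.

Lemma domain_lty : (mu Omega < +oo)%E.
Proof. exact: (bounded_lebesgue_row_lty mOmega bOmega). Qed.

Lemma integrable_bounded_fun (g : 'rV[R]_n -> R) B : measurable_fun Omega g ->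
  (forall x, Omega x -> `|g x| <= B) -> mu.-integrable Omega (EFin \o g).
Proof.
move=> mg gB; apply: (measurable_bounded_integrable mOmega domain_lty mg).
exists B; split; first exact: num_real.
by move=> C BC x Ox; exact: le_trans (gB x Ox) (ltW BC).
Qed.

Lemma integrable_bounded_mul (g h : 'rV[R]_n -> R) B : measurable_fun Omega g ->
  (forall x, Omega x -> `|g x| <= B) -> mu.-integrable Omega (EFin \o h) ->
  mu.-integrable Omega (fun x => (g x * h x)%:E).
Proof.
move=> mg gB ih.
apply: (integrableMr mOmega mg _ ih).
exists B; split; first exact: num_real.
by move=> C BC x Ox; exact: le_trans (gB x Ox) (ltW BC).
Qed.

Lemma LpP p (w : 'rV[R]_n -> R) : 1 <= p ->
  Lp Omega p w <-> measurable_fun Omega w /\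
    mu.-integrable Omega (fun x => (`|w x| `^ p)%:E).
Proof.
move=> p1; have p0 : 0 < p by exact: lt_le_trans p1.
have wp : (fun x => (`|w x| `^ p)%:E) \_ Omega =
    (fun x => (`|(w \_ Omega) x| `^ p)%:E).
  apply/funext => x; rewrite !patchE; case: ifPn => // _.
  by rewrite normr0 powR0 ?gt_eqF.
split=> [Lw|[mw iw]].
  have := Lfun_integrable p1 Lw; rewrite -wp.
  move=> /(integrable_mkcond _ mOmega) iw.
  split=> //; apply/(measurable_restrictT _ mOmega).
  by move: Lw => /andP[]; rewrite inE.
apply/andP; split; rewrite inE; first exact/(measurable_restrictT _ mOmega).
rewrite /= /finite_norm unlock /Lnorm poweR_lty//=.
move/(integrable_mkcond _ mOmega) : iw; rewrite wp => /integrableP[_].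
by under eq_integral do rewrite gee0_abs ?lee_fin ?powR_ge0//.
Qed.

Lemma Lp_integrable p (w : 'rV[R]_n -> R) : 1 <= p -> Lp Omega p w ->
  mu.-integrable Omega (EFin \o w).
Proof.
move=> p1 /(LpP _ p1)[mw iw].
apply: (@le_integrable _ _ _ _ _ mOmega _ (fun x => (1 + `|w x| `^ p)%:E)).
- exact/measurable_EFinP.
- move=> x _ /=; rewrite lee_fin [leRHS]ger0_norm ?addr_ge0 ?powR_ge0//.
  have [w1|w1] := leP `|w x| 1; first by rewrite (le_trans w1)// lerDl powR_ge0.
  by rewrite (le_trans (le1r_powR (ltW w1) p1))// lerDr.
- rewrite (_ : (fun x => _) = (EFin \o cst 1) \+ (fun x => (`|w x| `^ p)%:E))//.
  apply: (integrableD mOmega) => //.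
  apply: (@integrable_bounded_fun (cst 1) 1); first exact: measurable_cst.
  by move=> x _; rewrite normr1.
Qed.

Lemma Lp_bounded_mul p (g h : 'rV[R]_n -> R) B : 1 <= p ->
  measurable_fun Omega g -> (forall x, Omega x -> `|g x| <= B) ->
  Lp Omega p h -> Lp Omega p (fun x => g x * h x).
Proof.
move=> p1 mg gB /(LpP _ p1)[mh ih]; apply/(LpP _ p1); split.
  exact: measurable_funM.
have p0 : 0 <= p by exact: le_trans p1.
rewrite (_ : (fun x => _) =
    (fun x => (`|g x| `^ p * `|h x| `^ p)%:E)); last first.
  by apply/funext => x; rewrite normrM powRM.
apply: (@integrable_bounded_mul (fun x => `|g x| `^ p) (fun x => `|h x| `^ p)
  (B `^ p)) ih.
  apply: (measurableT_comp (measurable_powR p)).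
  exact: measurableT_comp.
move=> x Ox; rewrite ger0_norm ?powR_ge0// ge0_ler_powR// ?nnegrE ?gB//.
exact: le_trans (gB x Ox).
Qed.

Lemma Lp_bounded p (g : 'rV[R]_n -> R) B : 1 <= p ->
  measurable_fun Omega g -> (forall x, Omega x -> `|g x| <= B) -> Lp Omega p g.
Proof.
move=> p1 mg gB; rewrite (_ : g = fun x => g x * cst 1 x); last first.
  by apply/funext => x; rewrite mulr1.
apply: (Lp_bounded_mul p1 mg gB); apply/(LpP _ p1); split.
  exact: measurable_cst.
apply: (@integrable_bounded_fun (fun=> `|1| `^ p) 1).
  exact: measurable_cst.
by move=> x _; rewrite normr1 powR1 normr1.
Qed.

End domain.

(** * Integration by parts *)

Section domain_calculus.
Variables (R : realType) (n : nat) (Omega : set 'rV[R]_n).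
Hypotheses (oOmega : open Omega) (bOmega : bounded_set Omega).
Local Notation mu := (lebesgue_row R n).
Local Notation mOmega := (measurable_domain oOmega).

Definition C1_in (w : 'rV[R]_n -> R) : Prop :=
  forall x, Omega x -> {for x, continuous w} /\
    forall i, derivable w x (delta_mx 0 i) /\ {for x, continuous (partial i w)}.

Lemma bounded_sub_cube : exists M, forall x, ~ cube 0 M x -> ~ Omega x.
Proof.
have [M [_ MO]] := bOmega.
exists (`|M| + 2) => x xM Ox; apply: xM => i; rewrite mxE sub0r normrN.
have Mx : `|x| <= `|M| + 1.
  by apply: MO Ox; rewrite (le_lt_trans (ler_norm _))// ltrDl.
rewrite (le_lt_trans (normr_coord_le x i))// (le_lt_trans Mx)//.
by rewrite ltrD2l ltr1n.
Qed.

Lemma continuous_patch_supported (S : set 'rV[R]_n) (h : 'rV[R]_n -> R) :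
  closed S -> S `<=` Omega -> (forall x, Omega x -> {for x, continuous h}) ->
  (forall x, ~ S x -> h x = 0) -> continuous (h \_ Omega).
Proof.
move=> cS SO ch h0 x; have [Ox|nOx] := pselect (Omega x).
  have E : {near x, h =1 h \_ Omega}.
    apply: filterS (open_nbhs_nbhs (conj oOmega Ox)) => y Oy.
    by rewrite patchE mem_set.
  rewrite /continuous_at -(nbhs_singleton E).
  exact: cvg_trans (near_eq_cvg E) (ch x Ox).
have nSx : \near x, ~ S x.
  have nSx : (~` S) x by move=> /SO.
  exact: (open_nbhs_nbhs (conj (closed_openC cS) nSx)).
have E : \near x, (h \_ Omega) x = 0.
  by apply: filterS nSx => y nSy; rewrite patchE; case: ifPn => // _; exact: h0.
rewrite /continuous_at (nbhs_singleton E).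
exact: (cvg_near_cst 0 E).
Qed.

Lemma test_function_supported (f : 'rV[R]_n -> R) (x : 'rV[R]_n) :
  smooth f -> ~ closure [set x | f x != 0] x ->
  f x = 0 /\ forall i, partial i f x = 0.
Proof.
move=> sf nSf.
have E : \near x, f x = 0.
  apply: filterS (open_nbhs_nbhs (conj
    (closed_openC (@closed_closure _ [set x | f x != 0])) nSf)) => y /= nSy.
  apply/eqP; apply: contrapT => /negP fy.
  exact/nSy/subset_closure.
split; first exact: (nbhs_singleton E).
by move=> i; exact: (derive_eq0_near (delta_mx 0 i) E).2.
Qed.

(** The product [w * f], extended by 0, has continuous partial derivatives on
the whole space because [f] vanishes near the boundary; the integral of its
partial derivative is therefore 0. *)
Lemma domain_integration_by_parts (w f : 'rV[R]_n -> R) i :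
  C1_in w -> test_function Omega f ->
  [/\ mu.-integrable Omega (fun x => (w x * partial i f x)%:E),
      mu.-integrable Omega (fun x => (partial i w x * f x)%:E) &
      \int[mu]_(x in Omega) (w x * partial i f x) =
      - \int[mu]_(x in Omega) (partial i w x * f x)].
Proof.
move=> cw [sf cS SO]; set S := closure _ in SO cS.
have f0 x := @test_function_supported f x sf.
have [cf df] := sf [::]; have [cpf _] := sf [:: i].
have closedS : closed S by exact: closed_closure.
pose g1 x := w x * partial i f x; pose g2 x := partial i w x * f x.
have c1 : continuous (g1 \_ Omega).
  apply: (continuous_patch_supported closedS SO) => x.
    by move=> Ox; exact: (continuousM (cw x Ox).1 (cpf x)).
  by move=> /f0[_ pf0]; rewrite /g1 pf0 mulr0.
have c2 : continuous (g2 \_ Omega).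
  apply: (continuous_patch_supported closedS SO) => x.
    by move=> Ox; exact: (continuousM ((cw x Ox).2 i).2 (cf x)).
  by move=> /f0[fx0 _]; rewrite /g2 fx0 mulr0.
pose F := (w \* f) \_ Omega.
have dF x : derivable F x (delta_mx 0 i) /\
    partial i F x = (g1 \_ Omega) x + (g2 \_ Omega) x.
  have [Ox|nOx] := pselect (Omega x).
    have E : \near x, (w \* f) x = F x.
      apply: filterS (open_nbhs_nbhs (conj oOmega Ox)) => y Oy.
      by rewrite /F patchE mem_set.
    have dw := ((cw x Ox).2 i).1.
    split; first exact: (near_eq_derivable E (derivableM dw (df i x))).
    rewrite /partial -(near_eq_derive (delta_mx 0 i) E).
    rewrite (deriveM dw (df i x)) !patchE mem_set// /g1 /g2.
    by congr (_ + _); rewrite mulrC.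
  have E : \near x, F x = 0.
    have nSx : (~` S) x by move=> /SO.
    apply: filterS (open_nbhs_nbhs (conj (closed_openC closedS) nSx))
      => y /f0[fy0 _].
    rewrite /F patchE /= fy0 mulr0.
    by case: ifP.
  have [D1 D2] := derive_eq0_near (delta_mx 0 i) E.
  by split; [exact: D1|rewrite /partial D2 !patchE memNset// addr0].
have [M MO] := bounded_sub_cube.
have i1 : mu.-integrable setT (EFin \o (g1 \_ Omega)).
  apply: (integrable_continuous_supported c1 (M := M)) => x /MO nOx.
  by rewrite patchE memNset.
have i2 : mu.-integrable setT (EFin \o (g2 \_ Omega)).
  apply: (integrable_continuous_supported c2 (M := M)) => x /MO nOx.
  by rewrite patchE memNset.
have pE : partial i F = (g1 \_ Omega) \+ (g2 \_ Omega).
  by apply/funext => x; exact: (dF x).2.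
have F0 : (\int[mu]_x (partial i F x)%:E = 0)%E.
  apply: (integral_partial_supported (M := M)).
  - by move=> x; exact: (dF x).1.
  - by rewrite pE => x; exact: (continuousD (c1 x) (c2 x)).
  - by move=> x /MO nOx; rewrite /F patchE memNset.
have patchEFin (g : 'rV[R]_n -> R) :
    (EFin \o g) \_ Omega = EFin \o (g \_ Omega).
  by apply/funext => x; rewrite /= !patchE; case: ifP.
split.
- by apply/(integrable_mkcond _ mOmega); rewrite (patchEFin g1).
- by apply/(integrable_mkcond _ mOmega); rewrite (patchEFin g2).
- apply/eqP; rewrite -addr_eq0 Rintegral_mkcond.
  rewrite [X in _ + X]Rintegral_mkcond -RintegralD//; apply/eqP.
  transitivity (\int[mu]_x partial i F x); first by rewrite pE.
  by rewrite /Rintegral F0.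
Qed.

End domain_calculus.

(** * Weak and classical gradients *)

Section sobolev.
Variables (R : realType) (n : nat) (Omega : set 'rV[R]_n).
Hypotheses (oOmega : open Omega) (bOmega : bounded_set Omega).
Local Notation mu := (lebesgue_row R n).
Local Notation mOmega := (measurable_domain oOmega).

Lemma compact_closure_domain : compact (closure Omega).
Proof.
apply: bounded_closed_compact; last exact: closed_closure.
have [M [_ MO]] := bOmega.
exists (`|M| + 2); split; first exact: num_real.
move=> B MB x /(_ _ (nbhsx_ballx x 1 ltr01))[y [Oy xy]].
have yM : `|y| <= `|M| + 1.
  by apply: MO Oy; rewrite (le_lt_trans (ler_norm _))// ltrDl.
apply: le_trans (ltW MB); rewrite -(subrK y x) (le_trans (ler_normD _ _))//.
rewrite addrC -[2]/(1 + 1) addrA lerD//.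
by move: xy; rewrite -ball_normE => /ltW.
Qed.

Lemma continuous_closure_bounded (w : 'rV[R]_n -> R) :
  {within closure Omega, continuous w} ->
  exists2 B, 0 <= B & forall x, closure Omega x -> `|w x| <= B.
Proof.
move=> cw.
have [B [_ BP]] := compact_bounded (continuous_compact cw
  compact_closure_domain).
exists (`|B| + 1) => [|x Ox]; first by rewrite addr_ge0.
apply: (BP (`|B| + 1)); first by rewrite (le_lt_trans (ler_norm _))// ltrDl.
by exists x.
Qed.

Lemma continuous_closure_in (w : 'rV[R]_n -> R) :
  {within closure Omega, continuous w} ->
  forall x, Omega x -> {for x, continuous w}.
Proof.
move=> /(continuous_subspaceW (@subset_closure _ Omega)).
rewrite (continuous_open_subspace _ oOmega) => cw x Ox.
by apply: cw; rewrite inE.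
Qed.

Lemma C1_closure_in (w : 'rV[R]_n -> R) :
  C1_closure Omega w -> C1_in Omega w.
Proof.
move=> [cw dw] x Ox; split=> [|i]; first exact: (continuous_closure_in cw Ox).
have [Dw [g [cg gE]]] := dw i; split; first exact: Dw.
have E : {near x, g =1 partial i w}.
  by apply: filterS (open_nbhs_nbhs (conj oOmega Ox)) => y /gE.
apply: cvg_trans (near_eq_cvg E) _.
have gx : g y @[y --> x] --> g x := continuous_closure_in cg Ox.
by rewrite (gE x Ox) in gx.
Qed.

Lemma C1_in_measurable (w : 'rV[R]_n -> R) : C1_in Omega w ->
  measurable_fun Omega w /\ forall i, measurable_fun Omega (partial i w).
Proof.
move=> cw; split=> [|i]; apply: continuous_measurable_row => // x Ox.
  exact: (cw x Ox).1.
exact: ((cw x Ox).2 i).2.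
Qed.

Lemma test_function_bounded (f : 'rV[R]_n -> R) : test_function Omega f ->
  measurable_fun setT f /\ exists2 B, 0 <= B & forall x, `|f x| <= B.
Proof.
move=> [sf _ SO]; have [cf _] := sf [::]; split.
  by apply: continuous_measurable_row => [|x _]; [exact: openT|exact: cf].
have [M MO] := bounded_sub_cube bOmega.
apply: (continuous_supported_bounded cf (M := M)) => x /MO nOx.
by apply: (test_function_supported sf _).1 => /SO.
Qed.

Lemma test_functionM (f g : 'rV[R]_n -> R) :
  test_function Omega f -> smooth g -> test_function Omega (f \* g).
Proof.
move=> [sf cS SO] sg.
have fgf : closure [set x | (f \* g) x != 0] `<=` closure [set x | f x != 0].
  apply: closureS => x /=; apply: contraNN => /eqP ->.
  by rewrite mul0r.
split; first exact: smoothM.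
- by apply: subclosed_compact cS fgf; exact: closed_closure.
- exact: subset_trans SO.
Qed.

(** The difference of the weak and the classical gradient, multiplied by [f], is
orthogonal to every [soft_orthant]: the product of [f] with a smooth function is
again a test function. So no test function has to be constructed, and the
equality is obtained on the support of each given one. *)
Lemma weak_gradient_ae p u du (f : 'rV[R]_n -> R) i : 1 <= p ->
  sobolev Omega p u du -> C1_in Omega u -> test_function Omega f ->
  {ae mu, forall x, Omega x -> du x ord0 i * f x = partial i u x * f x}.
Proof.
move=> p1 [_ Ldu wdu] cu tf.
have [mdu _] := (LpP oOmega _ p1).1 (Ldu i).
have idu := Lp_integrable oOmega bOmega p1 (Ldu i).
have mpu := (C1_in_measurable cu).2 i.
have idf g : test_function Omega g ->
    mu.-integrable Omega (fun x => (du x ord0 i * g x)%:E).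
  move=> /test_function_bounded[mg [B _ gB]].
  under eq_fun do rewrite mulrC.
  apply: (integrable_bounded_mul oOmega (measurable_funTS mg) (B := B)) => //.
pose k x := (du x ord0 i - partial i u x) * f x.
have ik : mu.-integrable Omega (EFin \o k).
  have [_ ipf _] := domain_integration_by_parts oOmega bOmega i cu tf.
  rewrite (_ : EFin \o k = ((fun x => (du x ord0 i * f x)%:E) \-
    (fun x => (partial i u x * f x)%:E))%E).
    exact: (integrableB mOmega (idf f tf) ipf).
  by apply/funext => x; rewrite /k /= mulrBl.
have ik' : mu.-integrable setT (EFin \o (k \_ Omega)).
  rewrite (_ : EFin \o (k \_ Omega) = (EFin \o k) \_ Omega).
    exact/(integrable_mkcond _ mOmega).
  by apply/funext => x; rewrite /= !patchE; case: ifP.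
have [|N [mN N0 NP]] := ae_eq0_soft_orthant ik'.
  move=> a m.
  have tfs : test_function Omega (f \* soft_orthant a m).
    exact: (test_functionM tf (smooth_soft_orthant a m)).
  have [iupf ipf ibp] := domain_integration_by_parts oOmega bOmega i cu tfs.
  have := wdu _ tfs i; rewrite ibp => /oppr_inj/eqP.
  rewrite eq_sym -subr_eq0 -RintegralB//; [|exact: mOmega|exact: idf].
  move=> /eqP H.
  have E x : (k \_ Omega) x * soft_orthant a m x =
      ((fun x => du x ord0 i * (f \* soft_orthant a m) x -
      partial i u x * (f \* soft_orthant a m) x) \_ Omega) x.
    rewrite !patchE; case: ifP => _; last by rewrite mul0r.
    by rewrite /k /=; ring.
  under eq_integral do rewrite E.
  have iD := integrableB mOmega (idf _ tfs) ipf.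
  move: H; rewrite /Rintegral => H.
  rewrite -[LHS]fineK.
    by congr EFin; rewrite -[RHS]H [in RHS]integral_mkcond; congr fine;
      apply: eq_integral => x _; rewrite !patchE; case: ifP.
  apply: integrable_fin_num => //.
  rewrite (_ : (fun _ => _) =
    ((fun x => (du x ord0 i * (f \* soft_orthant a m)%R x)%:E) \-
    (fun x => (partial i u x * (f \* soft_orthant a m)%R x)%:E))%E \_ Omega).
    exact/(integrable_mkcond _ mOmega).
  by apply/funext => x; rewrite !patchE; case: ifP.
exists N; split=> // x /= h; apply: NP => /= kx; apply: h => Ox.
move: kx; rewrite patchE mem_set// /k mulrBl => /eqP.
by rewrite subr_eq0 => /eqP.
Qed.

End sobolev.

(** * Truncations and the maximum principle *)

(** A continuously differentiable nondecreasing function vanishing exactly where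
[e * s <= e * c]: a truncation at level [c], from above or from below according
to the sign [e], smooth enough for the classical chain rule. *)
Definition signed_sqr_pos {R : realType} (e c s : R) : R :=
  e * Num.max (e * (s - c)) 0 ^+ 2.

Section signed_sqr_pos.
Variables (R : realType) (e c : R).
Hypothesis e2 : e * e = 1.
Local Notation G := (signed_sqr_pos e c).

Lemma derivable_signed_sqr_pos (s : R) :
  derivable G s 1 /\ derive1 G s = 2 * Num.max (e * (s - c)) 0.
Proof.
have H : h^-1 *: (G (h + s) - G s) @[h --> 0^'] --> 2 * Num.max (e * (s - c)) 0.
  (* The increment differs from its linear part by at most [h ^+ 2]. *)
  apply/cvgrPdist_le => eps eps0; near=> h.
  have h0 : h != 0 by near: h; exact: nbhs_dnbhs_neq.
  have hs : `|h| <= eps.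
    near: h; apply: dnbhs0_le => //.
  rewrite -[_ *: _]/(h^-1 * _); apply: le_trans hs.
  have -> : 2 * Num.max (e * (s - c)) 0 - h^-1 * (G (h + s) - G s) =
      h^-1 * (2 * Num.max (e * (s - c)) 0 * h - (G (h + s) - G s)).
    by field.
  rewrite normrM normfV ler_pdivrMl ?normr_gt0// -normrM -expr2.
  rewrite (ger0_norm (sqr_ge0 h)) /G ler_norml.
  have -> : e * (h + s - c) = e * h + e * (s - c) by ring.
  set y := e * (s - c).
  have eh2 : h ^+ 2 = (e * h) ^+ 2 by rewrite exprMn [e ^+ 2]e2 mul1r.
  have -> : 2 * Num.max y 0 * h = e * (2 * Num.max y 0 * (e * h)).
    by rewrite -[LHS]mul1r -[X in X * _]e2; ring.
  rewrite eh2 -mulrBr -mulrBr; move: (e * h) => k.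
  have /orP[/eqP -> | /eqP ->] : (e == 1) || (e == -1).
    by rewrite -sqrf_eq1 expr2 e2.
  - by rewrite mul1r; case: (leP y 0) => y0; case: (leP (k + y) 0) => ky0;
      apply/andP; split; nra.
  - by rewrite mulN1r; case: (leP y 0) => y0; case: (leP (k + y) 0) => ky0;
      apply/andP; split; nra.
have H1 : h^-1 *: ((G \o shift s) (h *: 1) - G s) @[h --> 0^'] -->
    2 * Num.max (e * (s - c)) 0.
  under eq_fun do rewrite /= -[_ *: 1]/(_ * 1) mulr1.
  exact: H.
split; last exact/cvg_lim.
by apply/cvg_ex; eexists; exact: H1.
Unshelve. all: by end_near. Qed.

Lemma continuous_signed_sqr_pos' : continuous (derive1 G).
Proof.
rewrite (_ : derive1 G = fun s => 2 * Num.max (e * (s - c)) 0); last first.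
  by apply/funext => s; exact: (derivable_signed_sqr_pos s).2.
move=> s; apply: cvgM; first exact: cvg_cst.
apply: (@continuous_max _ _ (fun s => e * (s - c)) (cst 0)).
  by apply: cvgM; [exact: cvg_cst|apply: cvgB; [exact: cvg_id|exact: cvg_cst]].
exact: cvg_cst.
Qed.

End signed_sqr_pos.

Lemma spow_gt0 {R : realType} (p s : R) : 0 < s -> spow p s = s `^ (p - 1).
Proof.
move=> s0; rewrite /spow gtr0_norm// mulrC -[X in X * _]powRr1 ?ltW//.
rewrite -powRD; last by apply/implyP => _; rewrite gt_eqF.
by congr (_ `^ _); ring.
Qed.

Section comparison.
Variables (R : realType) (n : nat) (Omega : set 'rV[R]_n).
Hypotheses (oOmega : open Omega) (bOmega : bounded_set Omega).
Local Notation mu := (lebesgue_row R n).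
Local Notation mOmega := (measurable_domain oOmega).

Lemma continuous_comp_bounded (H : R -> R) (w : 'rV[R]_n -> R) B :
  continuous H -> (forall x, Omega x -> `|w x| <= B) ->
  exists C, forall x, Omega x -> `|H (w x)| <= C.
Proof.
move=> cH wB.
have [C [_ CP]] := compact_bounded (continuous_compact
  (continuous_subspaceT cH) (@segment_compact R (- B) B)).
exists (`|C| + 1) => x Ox; apply: (CP (`|C| + 1)).
  by rewrite (le_lt_trans (ler_norm _))// ltrDl.
by exists (w x) => //=; rewrite in_itv/= -ler_norml wB.
Qed.

Section composition.
Variable G : R -> R.
Hypotheses (dG : forall s, derivable G s 1) (cG' : continuous (derive1 G)).

Lemma derivable_continuous : continuous G.
Proof.
by move=> s; apply: differentiable_continuous; exact/derivable1_diffP.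
Qed.

Lemma C1_in_comp (w : 'rV[R]_n -> R) : C1_in Omega w ->
  C1_in Omega (G \o w) /\ forall x i, Omega x ->
    partial i (G \o w) x = derive1 G (w x) * partial i w x.
Proof.
move=> cw.
have D x i : Omega x -> derivable (G \o w) x (delta_mx 0 i) /\
    partial i (G \o w) x = derive1 G (w x) * partial i w x.
  move=> Ox; have [D1 D2] := derive_comp1 ((cw x Ox).2 i).1 (@dG (w x)).
  by split; [exact: D1|exact: D2].
split; last by move=> x i Ox; exact: (D x i Ox).2.
move=> x Ox; split=> [|i].
  exact: (continuous_comp (cw x Ox).1 (@derivable_continuous (w x))).
split; first exact: (D x i Ox).1.
have E : {near x, (fun x => derive1 G (w x) * partial i w x) =1
    partial i (G \o w)}.
  by apply: filterS (open_nbhs_nbhs (conj oOmega Ox)) => y Oy;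
    rewrite (D y i Oy).2.
apply: cvg_trans (near_eq_cvg E) _; rewrite (D x i Ox).2.
apply: cvgM; last exact: ((cw x Ox).2 i).2.
exact: (continuous_comp (cw x Ox).1 (@cG' (w x))).
Qed.

(** The gradient is expressed with the weak gradient [du] rather than with the
classical one, so that, for nondecreasing [G], testing the equation with
[G \o u] pairs the flux of [du] with a nonnegative multiple of [du]. *)
Lemma sobolev_comp p (u : 'rV[R]_n -> R) du : 1 <= p ->
  sobolev Omega p u du -> C1_closure Omega u ->
  sobolev Omega p (G \o u) (fun x => derive1 G (u x) *: du x).
Proof.
move=> p1 su Cu; have cu := C1_closure_in oOmega Cu.
have [Lu Ldu wdu] := su.
have [B _ uB] := continuous_closure_bounded bOmega Cu.1.
have {}uB x : Omega x -> `|u x| <= B by move=> /(@subset_closure _ Omega)/uB.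
have [cGu pGu] := C1_in_comp cu.
have [mGu mpGu] := C1_in_measurable oOmega cGu.
have mG'u : measurable_fun Omega (fun x => derive1 G (u x)).
  apply: (continuous_measurable_row oOmega) => x Ox.
  exact: (continuous_comp (cu x Ox).1 (@cG' (u x))).
have [C GuC] := continuous_comp_bounded derivable_continuous uB.
have [C' G'uC] := continuous_comp_bounded cG' uB.
split.
- exact: (Lp_bounded oOmega bOmega p1 mGu GuC).
- move=> i; rewrite (_ : (fun x => _) = fun x => derive1 G (u x) * du x ord0 i).
    exact: (Lp_bounded_mul oOmega p1 mG'u G'uC (Ldu i)).
  by apply/funext => x; rewrite mxE.
- move=> f tf i.
  have [_ iGf ->] := domain_integration_by_parts oOmega bOmega i cGu tf.
  rewrite /Rintegral; congr (- fine _).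
  have mdu : measurable_fun Omega (fun x => du x ord0 i).
    exact: (proj1 ((LpP oOmega _ p1).1 (Ldu i))).
  have mf : measurable_fun Omega f.
    by have [mf _] := test_function_bounded bOmega tf;
      exact: measurable_funTS.
  apply: ae_eq_integral; first exact: mOmega.
  + exact: measurable_int iGf.
  + apply/measurable_EFinP; rewrite (_ : (fun x => _) =
      fun x => (derive1 G (u x) * du x ord0 i) * f x).
      by apply: measurable_funM => //; exact: measurable_funM.
    by apply/funext => x; rewrite mxE.
  + apply: filterS (weak_gradient_ae oOmega bOmega i p1 su cu tf) => x E Ox.
    by rewrite mxE pGu// -!mulrA E.
Qed.

(** The gradient term of the equation tested with [G \o u] is the integral of
[G' (u) * |du| ^ p >= 0], so that it can be dropped. *)
Lemma weak_neumann_test_comp p (u h : 'rV[R]_n -> R) : 1 <= p ->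
  (forall s, 0 <= derive1 G s) ->
  weak_neumann Omega p u h -> C1_closure Omega u ->
  mu.-integrable Omega (fun x => (h x * G (u x))%:E) /\
  \int[mu]_(x in Omega) (spow p (u x) * G (u x)) <=
  \int[mu]_(x in Omega) (h x * G (u x)).
Proof.
move=> p1 G'0 [du su wu] Cu.
have [ih <-] := wu _ _ (sobolev_comp p1 su Cu); split=> //.
rewrite lerDr Rintegral_ge0// => x _.
rewrite /dotp; apply: sumr_ge0 => i _; rewrite /vpow !mxE.
rewrite mulrCA !mulrA -mulrA mulr_ge0//; last by rewrite -expr2 sqr_ge0.
by rewrite mulr_ge0// powR_ge0.
Qed.

End composition.

(** A maximum principle: testing with a truncation of [u] at level [c] bounds
the integral of [(u ^ (p - 1) - h) * G u] by 0, while this integrand is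
nonnegative, and positive wherever [e * u] exceeds [e * c]. That set is open and
negligible, hence empty. Here [e = 1] gives upper and [e = -1] lower bounds. *)
Lemma weak_neumann_comparison p (u h : 'rV[R]_n -> R) (e c : R) :
  1 < p -> 0 < c -> e * e = 1 ->
  weak_neumann Omega p u h -> C1_closure Omega u ->
  (forall x, Omega x -> 0 < u x) ->
  (forall x, Omega x -> e * h x <= e * c `^ (p - 1)) ->
  forall x, Omega x -> e * u x <= e * c.
Proof.
move=> p1 c0 e2 wn Cu u0 hc x0 Ox0.
pose G := signed_sqr_pos e c.
have dG s : derivable G s 1 by exact: (derivable_signed_sqr_pos c e2 s).1.
have cG' : continuous (derive1 G) by exact: continuous_signed_sqr_pos'.
have G'0 s : 0 <= derive1 G s.
  by rewrite (derivable_signed_sqr_pos c e2 s).2 mulr_ge0// le_max lexx orbT.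
have [ihG leG] := weak_neumann_test_comp dG cG' (ltW p1) G'0 wn Cu.
have cu := C1_closure_in oOmega Cu.
have [B _ uB] := continuous_closure_bounded bOmega Cu.1.
have {}uB x : Omega x -> `|u x| <= B by move=> /(@subset_closure _ Omega)/uB.
have [mGu _] := C1_in_measurable oOmega (C1_in_comp dG cG' cu).1.
have [mu_ _] := C1_in_measurable oOmega cu.
have [C GuC] := continuous_comp_bounded (derivable_continuous dG) uB.
have spowE x : Omega x -> spow p (u x) = u x `^ (p - 1).
  by move=> /u0; exact: spow_gt0.
have isG : mu.-integrable Omega (fun x => (spow p (u x) * G (u x))%:E).
  apply: (@integrable_bounded_fun _ _ _ oOmega bOmega
    (fun x => spow p (u x) * G (u x)) (B `^ (p - 1) * C)).
    apply: measurable_funM => //; rewrite /spow.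
    apply: measurable_funM => //.
    apply: (measurableT_comp (measurable_powR (p - 2))).
    exact: measurableT_comp.
  move=> x Ox; rewrite normrM ler_pM// ?GuC// spowE// ger0_norm ?powR_ge0//.
  have ux := uB x Ox; rewrite gtr0_norm ?u0// in ux.
  have ux0 := ltW (u0 x Ox).
  apply: ge0_ler_powR;
    by rewrite ?nnegrE ?subr_ge0 ?(ltW p1) ?(le_trans ux0 ux).
pose D x := spow p (u x) * G (u x) - h x * G (u x).
have iD : mu.-integrable Omega (EFin \o D).
  rewrite (_ : EFin \o D = ((fun x => (spow p (u x) * G (u x))%:E) \-
    (fun x => (h x * G (u x))%:E))%E)//.
  exact: (integrableB mOmega isG ihG).
have D0 : \int[mu]_(x in Omega) D x <= 0.
  by rewrite RintegralB ?subr_le0//; exact: mOmega.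
have Dpos x : Omega x -> e * c < e * u x -> 0 < D x.
  move=> Ox cux.
  have y0 : 0 < e * (u x - c) by rewrite mulrBr subr_gt0.
  rewrite /D -mulrBl spowE// /G /signed_sqr_pos max_l ?ltW//.
  rewrite mulrA mulr_gt0 ?exprn_gt0// mulrC mulrBr subr_gt0.
  apply: le_lt_trans (hc x Ox) _.
  have p10 : 0 < p - 1 by rewrite subr_gt0.
  have /orP[/eqP e1 | /eqP e1] : (e == 1) || (e == -1).
    by rewrite -sqrf_eq1 expr2 e2.
  - move: cux; rewrite e1 !mul1r => cux.
    by rewrite gt0_ltr_powR ?nnegrE ?ltW ?u0.
  - move: cux; rewrite e1 !mulN1r !ltrN2 => cux.
    by rewrite gt0_ltr_powR ?nnegrE ?ltW ?u0.
have Dge0 x : Omega x -> 0 <= D x.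
  move=> Ox; have [ucx|cux] := leP (e * u x) (e * c).
    rewrite /D /G /signed_sqr_pos max_r ?mulrBr ?subr_le0// expr0n/= !mulr0.
    by rewrite subrr.
  exact: ltW (Dpos x Ox cux).
have ID0 : (\int[mu]_(x in Omega) (D x)%:E = 0)%E.
  apply/eqP; rewrite eq_le integral_ge0 ?andbT; last first.
    by move=> x Ox; rewrite lee_fin Dge0.
  by rewrite -[leLHS]fineK ?integrable_fin_num ?lee_fin//; exact: mOmega.
have aeD : ae_eq mu Omega (EFin \o D) (cst 0%E).
  apply/(ae_eq_integral_abs _ mOmega); first exact: measurable_int iD.
  rewrite -[RHS]ID0; apply: eq_integral => x /set_mem Ox.
  by rewrite /= ger0_norm// Dge0.
rewrite leNgt; apply/negP => cux0.
pose P := Omega `&` [set x | e * c < e * u x].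
have oP : open P.
  rewrite openE => x [Ox cux]; apply: filterI; first exact: open_nbhs_nbhs.
  have cux' : u y @[y --> x] --> u x := (cu x Ox).1.
  have ceu : e * u y @[y --> x] --> e * u x by exact: cvgM (cvg_cst e) cux'.
  exact: (@cvgr_gt R _ _ _ (fun y => e * u y) _ ceu _ cux).
have mP := open_measurable_row oP.
have Pgt0 := nbhs_lebesgue_row_gt0 mP
  (open_nbhs_nbhs (conj oP (conj Ox0 cux0))).
move: aeD => [N [mN N0 NP]].
suff : (mu P <= mu N)%E.
  by rewrite N0 leNgt Pgt0.
apply: le_measure; rewrite ?inE//.
move=> x [Ox cux]; apply: NP => /= /(_ Ox)[Dx0].
by have := Dpos x Ox cux; rewrite Dx0 ltxx.
Qed.

Lemma weak_neumann_cst p (a : R) (h : 'rV[R]_n -> R) : 1 < p -> 0 < a ->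
  (forall x, h x = a `^ (p - 1)) -> weak_neumann Omega p (fun=> a) h.
Proof.
move=> p1 a0 hE; have p1' := ltW p1.
have ca : C1_in Omega (cst a).
  move=> x _; split=> [|i]; first exact: cst_continuous.
  split; first exact: derivable_cst.
  rewrite (_ : partial i (cst a) = cst 0); first exact: cst_continuous.
  by apply/funext => y; rewrite /partial derive_cst.
exists (fun=> 0).
  split.
  - apply: (@Lp_bounded _ _ _ oOmega bOmega p (cst a) `|a|) => //.
  - move=> i.
    have -> : (fun=> (0 : 'rV[R]_n) ord0 i) = cst 0 :> ('rV[R]_n -> R).
      by apply/funext => x; rewrite mxE.
    apply: (@Lp_bounded _ _ _ oOmega bOmega p (cst 0) 0) => // x _.
    by rewrite normr0.
  - move=> f tf i.
    have [_ _ ->] := domain_integration_by_parts oOmega bOmega i ca tf.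
    congr (- _); apply: eq_Rintegral => x _.
    by rewrite /partial derive_cst mxE.
move=> phi dphi [Lphi _ _]; split.
  rewrite (_ : (fun x => _) =
      fun x => (cst (a `^ (p - 1)) x * phi x)%:E); last first.
    by apply/funext => x; rewrite hE.
  apply: (@integrable_bounded_mul _ _ _ oOmega _ _ `|a `^ (p - 1)|) => //.
  exact: (Lp_integrable oOmega bOmega p1' Lphi).
rewrite (_ : \int[mu]_(x in Omega) dotp _ _ = 0) ?add0r; last first.
  rewrite (eq_Rintegral mu (g := cst 0)) ?Rintegral_cst ?mul0r//.
    exact: mOmega.
  move=> x _; rewrite /dotp big1// => i _.
  by rewrite /vpow scaler0 mxE mul0r.
by apply: eq_Rintegral => x _; rewrite hE spow_gt0.
Qed.

End comparison.

(** * Distances of logarithms and uniqueness *)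

(** As [A < p] and [D < q], a positive [s] or [t] cannot be bounded through its
own diagonal term; through the cross terms, [s] is bounded by a multiple of [t]
and [t] by a multiple of [s], with product [B * C / (p * q) < 1]. *)
Lemma ln_contraction_fixed {R : realType} (A B C D p q s t : R) :
  0 < p -> 0 < q -> 0 < B -> 0 < C -> A < p -> D < q -> B * C < p * q ->
  0 <= s -> 0 <= t ->
  s <= Num.max (A * s) (B * t) / p -> t <= Num.max (C * s) (D * t) / q ->
  s = 0 /\ t = 0.
Proof.
move=> p0 q0 B0 C0 Ap Dq BCpq s0 t0.
rewrite !ler_pdivlMr// !le_max => sp tq.
have [s0' | s_gt0] := leP s 0.
  have -> : s = 0 by apply/eqP; rewrite eq_le s0' s0.
  split=> //; apply/eqP; rewrite eq_le t0 andbT leNgt; apply/negP => t_gt0.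
  by move: tq => /orP[]; nra.
have sB : s * p <= B * t.
  move: sp => /orP[|//]; rewrite mulrC ler_pM2r// => pA; exfalso.
  by move: Ap; rewrite ltNge pA.
have t_gt0 : 0 < t by nra.
have tC : t * q <= C * s.
  move: tq => /orP[//|]; rewrite mulrC ler_pM2r// => qD; exfalso.
  by move: Dq; rewrite ltNge qD.
exfalso.
have : s * p * (t * q) <= B * t * (C * s) by rewrite ler_pM// mulr_ge0// ltW.
have : B * C * (s * t) < p * q * (s * t) by rewrite ltr_pM2r// mulr_gt0.
by nra.
Qed.

(** The map [s |-> s ^ alpha] is Lipschitz with constant [|alpha|] for the
distance of logarithms; written multiplicatively to be summed. *)
Lemma powR_ln_dist {R : realType} (alpha s a t : R) : 0 < s -> 0 < a ->
  `|ln s - ln a| <= t ->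
  expR (- (`|alpha| * t)) * a `^ alpha <= s `^ alpha <=
  expR (`|alpha| * t) * a `^ alpha.
Proof.
move=> s0 a0 st.
rewrite /powR !gt_eqF// -!expRD !ler_expR.
have : `|alpha * (ln s - ln a)| <= `|alpha| * t by rewrite normrM ler_wpM2l.
by rewrite ler_norml mulrBr => /andP[h1 h2]; apply/andP; split; lra.
Qed.

Section domain_bounds.
Variables (R : realType) (n : nat) (Omega : set 'rV[R]_n).
Hypotheses (oOmega : open Omega) (bOmega : bounded_set Omega)
  (Omega0 : Omega !=set0).

(** One step of the contraction: a solution is close to the constant [a], in the
uniform distance of logarithms, when the functions in its datum are close to
[a1] and [b1]. Powers scale this distance by their exponents, a sum of positive
terms does not increase it, and the comparison with constants divides it by
[p - 1]. *)
Lemma weak_neumann_ln_dist p (u f g : 'rV[R]_n -> R)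
    (a a1 b1 alpha beta s t : R) :
  1 < p -> 0 < a -> 0 < a1 -> 0 < b1 ->
  a `^ (p - 1) = a1 `^ alpha + b1 `^ beta ->
  weak_neumann Omega p u (fun x => f x `^ alpha + g x `^ beta) ->
  C1_closure Omega u ->
  (forall x, Omega x -> [/\ 0 < u x, 0 < f x & 0 < g x]) ->
  (forall x, Omega x -> `|ln (f x) - ln a1| <= s) ->
  (forall x, Omega x -> `|ln (g x) - ln b1| <= t) ->
  forall x, Omega x ->
    `|ln (u x) - ln a| <= Num.max (`|alpha| * s) (`|beta| * t) / (p - 1).
Proof.
move=> p1 a0 a10 b10 aE wn Cu pos fs gt x Ox.
set m := Num.max _ _.
have p10 : 0 < p - 1 by rewrite subr_gt0.
have u0 y : Omega y -> 0 < u y by move=> /pos[].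
have cE (r : R) : 0 < expR (r / (p - 1)) * a /\
    (expR (r / (p - 1)) * a) `^ (p - 1) = expR r * a `^ (p - 1).
  split; first by rewrite mulr_gt0// expR_gt0.
  rewrite powRM ?expR_ge0 ?ltW//; congr (_ * _).
  by rewrite /powR gt_eqF ?expR_gt0// expRK mulrCA divff ?mulr1// gt_eqF.
have h_le y : Omega y -> f y `^ alpha + g y `^ beta <= expR m * a `^ (p - 1).
  move=> Oy; have [_ f0 g0] := pos y Oy.
  have /andP[_ h1] := powR_ln_dist alpha f0 a10 (fs y Oy).
  have /andP[_ h2] := powR_ln_dist beta g0 b10 (gt y Oy).
  rewrite aE mulrDr lerD//.
    by apply: le_trans h1 _; rewrite ler_wpM2r ?powR_ge0// ler_expR le_max lexx.
  apply: le_trans h2 _; rewrite ler_wpM2r ?powR_ge0// ler_expR le_max lexx.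
  by rewrite orbT.
have h_ge y : Omega y ->
    expR (- m) * a `^ (p - 1) <= f y `^ alpha + g y `^ beta.
  move=> Oy; have [_ f0 g0] := pos y Oy.
  have /andP[h1 _] := powR_ln_dist alpha f0 a10 (fs y Oy).
  have /andP[h2 _] := powR_ln_dist beta g0 b10 (gt y Oy).
  rewrite aE mulrDr lerD//.
    apply: le_trans _ h1; rewrite ler_wpM2r ?powR_ge0// ler_expR lerN2.
    by rewrite le_max lexx.
  apply: le_trans _ h2; rewrite ler_wpM2r ?powR_ge0// ler_expR lerN2.
  by rewrite le_max lexx orbT.
have up : u x <= expR (m / (p - 1)) * a.
  rewrite -[leLHS]mul1r -[leRHS]mul1r.
  apply: (weak_neumann_comparison oOmega bOmega p1 (cE m).1 (mulr1 1) wn Cu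
    u0) => //.
  by move=> y Oy; rewrite !mul1r (cE m).2 h_le.
have low : expR (- m / (p - 1)) * a <= u x.
  have eN1 : (-1) * (-1) = 1 :> R by rewrite mulrNN mulr1.
  rewrite -lerN2 -[leLHS]mulN1r -[leRHS]mulN1r.
  apply: (weak_neumann_comparison oOmega bOmega p1 (cE (- m)).1 eN1 wn Cu
    u0) => //.
  by move=> y Oy; rewrite !mulN1r lerN2 (cE (- m)).2 h_ge.
have lnE (r : R) : ln (expR r * a) = r + ln a.
  by rewrite lnM ?posrE ?expR_gt0// expRK.
rewrite ler_norml; apply/andP; split.
  rewrite lerBrDr -mulNr -lnE ler_ln ?posrE ?u0//.
  by rewrite mulr_gt0// expR_gt0.
by rewrite lerBlDr -lnE ler_ln ?posrE ?u0// mulr_gt0// expR_gt0.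
Qed.

Lemma intC1_pos_bounds (w : 'rV[R]_n -> R) : intC1_pos Omega w ->
  exists m M, 0 < m /\ forall x, Omega x -> m <= w x <= M.
Proof.
move=> [[cw _] w0].
have [B _ wB] := continuous_closure_bounded bOmega cw.
have cO0 : closure Omega !=set0.
  by have [x Ox] := Omega0; exists x; exact: subset_closure.
have [c cO cmin] := EVT_min_rV cO0 (compact_closure_domain bOmega) cw.
exists (w c), B; split; first by apply: w0; exact: set_mem.
move=> x /(@subset_closure _ Omega) Ox.
by rewrite cmin ?inE// (le_trans (ler_norm _))// wB.
Qed.

(** The uniform distance [s] of [ln w] to [ln a] is finite because [w] is
bounded and bounded away from 0 on the compact closure of the domain. *)
Lemma intC1_pos_ln_dist (w : 'rV[R]_n -> R) (a : R) : intC1_pos Omega w ->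
  exists s, [/\ 0 <= s, forall x, Omega x -> `|ln (w x) - ln a| <= s &
    forall t, (forall x, Omega x -> `|ln (w x) - ln a| <= t) -> s <= t].
Proof.
move=> pw; have [m [M [m0 wmM]]] := intC1_pos_bounds pw.
pose E := [set `|ln (w x) - ln a| | x in Omega].
have [x0 Ox0] := Omega0.
have E0 : E !=set0 by exists `|ln (w x0) - ln a|; exists x0.
have Eub : has_ubound E.
  exists (`|ln m| + `|ln M| + `|ln a|) => _ [x Ox <-].
  rewrite (le_trans (ler_normB _ _))// lerD2r.
  have /andP[mw wM] := wmM x Ox.
  have w0 : 0 < w x by exact: lt_le_trans mw.
  have l1 : ln m <= ln (w x) by rewrite ler_ln.
  have l2 : ln (w x) <= ln M by rewrite ler_ln// posrE (lt_le_trans w0).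
  rewrite ler_norml; apply/andP; split.
    have := ler_norm (- ln m); rewrite normrN; have := normr_ge0 (ln M); lra.
  have := ler_norm (ln M); have := normr_ge0 (ln m); lra.
have sE x : Omega x -> `|ln (w x) - ln a| <= sup E.
  by move=> Ox; apply: ub_le_sup => //; exists x.
exists (sup E); split => //; first exact: le_trans (sE x0 Ox0).
by move=> t wt; apply: ge_sup => // _ [x Ox <-]; exact: wt.
Qed.

Lemma within_closure_cst (w : 'rV[R]_n -> R) (a : R) :
  {within closure Omega, continuous w} -> (forall x, Omega x -> w x = a) ->
  forall x, closure Omega x -> w x = a.
Proof.
move=> /subspace_continuousP cw wa x cOx.
apply/eqP; apply: contrapT => /negP wxa.
have d0 : 0 < `|w x - a| by rewrite normr_gt0 subr_eq0.
have /cvgrPdist_lt/(_ _ d0) := cw x cOx.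
rewrite near_withinE => /cOx[y [Oy]].
move=> /(_ (subset_closure Oy)).
by rewrite -[X in `|X - _|]/(w x) -[X in `|_ - X|]/(w y) (wa y Oy) ltxx.
Qed.

Lemma intC1tau_pos_cst tau (a : R) : 0 < a -> intC1tau_pos Omega tau (fun=> a).
Proof.
move=> a0; have p0 i : partial i (fun=> a) = (fun=> 0) :> ('rV[R]_n -> R).
  by apply/funext => x; rewrite /partial derive_cst.
split=> //; split.
  split; first by apply: continuous_subspaceT; exact: cst_continuous.
  move=> i; split=> [x _|]; first exact: derivable_cst.
  exists (fun=> 0); rewrite p0; split=> //.
  by apply: continuous_subspaceT; exact: cst_continuous.
by move=> i; exists 0 => x y _ _; rewrite p0 subrr normr0 mul0r.
Qed.

Lemma intC1tau_pos_C1 tau (w : 'rV[R]_n -> R) :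
  intC1tau_pos Omega tau w -> intC1_pos Omega w.
Proof. by move=> [[]]. Qed.

(** The functions [phi] and [y] lie between positive constants on the domain. *)
Lemma in_order_interval_cst (phi y : 'rV[R]_n -> R) (a : R) :
  0 < a -> intC1_pos Omega phi -> intC1_pos Omega y ->
  exists2 Lambda0, 0 < Lambda0 & forall Lambda, Lambda0 <= Lambda ->
    in_order_interval Omega (fun x => Lambda^-1 * phi x)
      (fun x => Lambda * y x) (fun=> a).
Proof.
move=> a0 /intC1_pos_bounds[m' [M [_ phiM]]] /intC1_pos_bounds[m [M' [m0 my]]].
exists (`|M| / a + a / m + 1).
  by rewrite ltr_wpDl// addr_ge0 ?divr_ge0// ltW.
move=> L hL x Ox.
have q1 : 0 <= `|M| / a by rewrite divr_ge0// ltW.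
have q2 : 0 <= a / m by rewrite divr_ge0// ltW.
have L0 : 0 < L by lra.
have LM : `|M| / a <= L by lra.
have Lm : a / m <= L by lra.
have /andP[_ pM] := phiM x Ox; have /andP[ym _] := my x Ox.
apply/andP; split.
  rewrite ler_pdivrMl// (le_trans pM)// (le_trans (ler_norm _))//.
  by rewrite -ler_pdivrMr.
by rewrite ler_pdivrMr// in Lm; rewrite (le_trans Lm)// ler_wpM2l// ltW.
Qed.

End domain_bounds.

(** * Existence and uniqueness *)

Unset Implicit Arguments.

Theorem theorem4p1 (R : realType) (N : nat) (hN : (2 <= N)%N)
  (Omega : set 'rV[R]_N)
  (hOmega : bounded_domain Omega) (hbd : smooth_boundary Omega)
  (p1 p2 : R) (hp1 : 1 < p1 < N%:R) (hp2 : 1 < p2 < N%:R)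
  (alpha1 beta1 alpha2 beta2 : R)
  (halpha1 : -1 < alpha1 < 0) (hbeta2 : -1 < beta2 < 0)
  (hbeta1 : -1 < beta1 < p1 - 1) (halpha2 : -1 < alpha2 < p2 - 1)
  (lambda1 lambda2 : R) (phi1 phi2 : 'rV[R]_N -> R)
  (hlambda1 : first_eigenvalue Omega p1 lambda1) (hlambda1_gt0 : 0 < lambda1)
  (hlambda2 : first_eigenvalue Omega p2 lambda2) (hlambda2_gt0 : 0 < lambda2)
  (hphi1 : eigenfunction Omega p1 lambda1 phi1)
  (hphi1_pos : intC1_pos Omega phi1)
  (hphi2 : eigenfunction Omega p2 lambda2 phi2)
  (hphi2_pos : intC1_pos Omega phi2)
  (y1 y2 : 'rV[R]_N -> R)
  (hy1 : weak_neumann Omega p1 y1 (fun=> 1)) (hy1_pos : intC1_pos Omega y1)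
  (hy2 : weak_neumann Omega p2 y2 (fun=> 1)) (hy2_pos : intC1_pos Omega y2) :
  let gamma1 := Num.max (- alpha1) (- beta1) in
  let gamma2 := Num.max (- alpha2) (- beta2) in
  let good (Lambda tau : R) (u v : 'rV[R]_N -> R) :=
    [/\ solution_P Omega p1 p2 alpha1 beta1 alpha2 beta2 u v,
        intC1tau_pos Omega tau u, intC1tau_pos Omega tau v,
        in_order_interval Omega (fun x => Lambda^-1 * phi1 x)
          (fun x => Lambda * y1 x) u &
        in_order_interval Omega (fun x => Lambda^-1 * phi2 x)
          (fun x => Lambda * y2 x) v] in
  exists2 Lambda0 : R, 0 < Lambda0 & forall Lambda : R, Lambda0 <= Lambda ->
    exists (tau : R) (u v : 'rV[R]_N -> R),
      [/\ 0 < tau < 1, good Lambda tau u v &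
          -1 < alpha2 < 0 -> -1 < beta1 < 0 ->
          Num.max (- gamma1 * alpha1 / (p1 - 1)) (- gamma2 * beta1 / (p2 - 1))
            < p1 - 1 ->
          Num.max (- gamma1 * alpha2 / (p1 - 1)) (- gamma2 * beta2 / (p2 - 1))
            < p2 - 1 ->
          forall (tau' : R) (u' v' : 'rV[R]_N -> R),
            0 < tau' < 1 -> good Lambda tau' u' v' ->
            forall x, closure Omega x -> u' x = u x /\ v' x = v x].

Proof.
move=> gamma1 gamma2 good.
have [oO _ O0 bO] := hOmega.
have [p1gt1 _] := andP hp1; have [p2gt1 _] := andP hp2.
have P0 : 0 < p1 - 1 by rewrite subr_gt0.
have Q0 : 0 < p2 - 1 by rewrite subr_gt0.
have [_ alpha1_lt0] := andP halpha1; have [_ beta2_lt0] := andP hbeta2.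
have [_ beta1_lt] := andP hbeta1; have [_ alpha2_lt] := andP halpha2.
have [a [b [a0 b0 aE bE]]] :=
  constant_solution P0 Q0 alpha1_lt0 beta2_lt0 beta1_lt alpha2_lt.
have [L1 L10 ord1] := in_order_interval_cst bO O0 a0 hphi1_pos hy1_pos.
have [L2 L20 ord2] := in_order_interval_cst bO O0 b0 hphi2_pos hy2_pos.
exists (Num.max L1 L2); first by rewrite lt_max L10.
move=> Lambda; rewrite ge_max => /andP[L1L L2L].
exists 2^-1, (fun=> a), (fun=> b); split.
- by apply/andP; split; lra.
- split.
  + split=> //.
      exact: (weak_neumann_cst oO bO p1gt1 a0 (fun=> esym aE)).
    exact: (weak_neumann_cst oO bO p2gt1 b0 (fun=> esym bE)).
  + exact: intC1tau_pos_cst.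
  + exact: intC1tau_pos_cst.
  + exact: ord1.
  + exact: ord2.
move=> /andP[_ alpha2_lt0] /andP[_ beta1_lt0] cond1 cond2 tau' u v _.
move=> [[uv0 wu wv] /intC1tau_pos_C1 Cu /intC1tau_pos_C1 Cv _ _].
have [s [s0 us smin]] := intC1_pos_ln_dist bO O0 a Cu.
have [t [t0 vt tmin]] := intC1_pos_ln_dist bO O0 b Cv.
have hs : s <= Num.max (- alpha1 * s) (- beta1 * t) / (p1 - 1).
  apply: smin => x Ox; rewrite -(ltr0_norm alpha1_lt0) -(ltr0_norm beta1_lt0).
  apply: (weak_neumann_ln_dist oO bO p1gt1 a0 a0 b0 aE wu Cu.1 _ us vt Ox).
  by move=> y Oy; have [] := uv0 y Oy.
have ht : t <= Num.max (- alpha2 * s) (- beta2 * t) / (p2 - 1).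
  apply: tmin => x Ox; rewrite -(ltr0_norm alpha2_lt0) -(ltr0_norm beta2_lt0).
  apply: (weak_neumann_ln_dist oO bO p2gt1 b0 a0 b0 bE wv Cv.1 _ us vt Ox).
  by move=> y Oy; have [] := uv0 y Oy.
have [s_eq0 t_eq0] : s = 0 /\ t = 0.
  apply: (ln_contraction_fixed P0 Q0 _ _ _ _ _ s0 t0 hs ht);
    rewrite ?oppr_gt0//.
  - move: cond1; rewrite gt_max ltr_pdivrMr// => /andP[+ _].
    have : - alpha1 <= gamma1 by rewrite le_max lexx.
    by nra.
  - move: cond2; rewrite gt_max [X in _ && X]ltr_pdivrMr// => /andP[_].
    have : - beta2 <= gamma2 by rewrite le_max lexx orbT.
    by nra.
  - move: cond1; rewrite gt_max [X in _ && X]ltr_pdivrMr// => /andP[_].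
    have : - alpha2 <= gamma2 by rewrite le_max lexx.
    by nra.
have eq_ln (w c : R) : 0 < w -> 0 < c -> `|ln w - ln c| <= 0 -> w = c.
  move=> w0 c0; rewrite normr_le0 subr_eq0 => /eqP; apply: ln_inj => //.
have ua x : Omega x -> u x = a.
  move=> Ox; apply: eq_ln (uv0 x Ox).1 a0 _.
  by rewrite -s_eq0; exact: us.
have vb x : Omega x -> v x = b.
  move=> Ox; apply: eq_ln (uv0 x Ox).2 b0 _.
  by rewrite -t_eq0; exact: vt.
move=> x cOx; split.
  exact: (within_closure_cst Cu.1.1 ua cOx).
exact: (within_closure_cst Cv.1.1 vb cOx).
Qed.
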